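(* Let $0<\beta<1$ and let $\nu$ be real. The following inequalities hold for all $x>0$. (1) If $\nu>-\frac{1}{2}$, then $$\int_0^x\mathrm{e}^{-\beta u}u^\nu \mathbf{L}_\nu(u)\,\mathrm{d}u<\frac{2\nu+3+\sqrt{2(2\nu+3)}}{(2\nu+1)(1-\beta)}\,\mathrm{e}^{-\beta x}x^\nu \mathbf{L}_{\nu+1}(x).$$ (2) If $\nu>-\frac{1}{2}$, then $$\int_0^x\mathrm{e}^{-\beta u}u^\nu \mathbf{L}_\nu(u)\,\mathrm{d}u<\frac{2\nu+3+2\sqrt{2}}{(2\nu+1)(1-\beta)}\,\mathrm{e}^{-\beta x}x^\nu \mathbf{L}_{\nu+1}(x).$$ (3) If $\nu>\frac{1}{2}$, then $$\int_0^x\mathrm{e}^{-\beta u}u^\nu \mathbf{L}_{\nu}(u)\,\mathrm{d}u>\frac{1}{1-\beta}\bigg\{\bigg(1-\frac{2\nu(2\nu+1+2\sqrt{2})}{(2\nu-1)(1-\beta)}\frac{1}{x}\bigg)\mathrm{e}^{-\beta x}x^\nu \mathbf{L}_{\nu}(x)-\frac{\gamma(2\nu+1,\beta x)}{\sqrt{\pi}\,2^\nu\beta^{2\nu+1}\Gamma(\nu+\frac{3}{2})}\bigg\}.$$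
   Context: $\mathbf{L}_\nu(x)$ denotes the modified Struve function of the first kind, given for $x>0$ by $$\mathbf{L}_\nu(x)=\sum_{k=0}^\infty\frac{(\frac{1}{2}x)^{\nu+2k+1}}{\Gamma\big(k+\frac{3}{2}\big)\Gamma\big(k+\nu+\frac{3}{2}\big)},$$ and $\gamma(a,x)=\int_0^x\mathrm{e}^{-u}u^{a-1}\,\mathrm{d}u$ is the lower incomplete gamma function. *)

(* Defs.v *)
From Stdlib Require Import Reals.
From Coquelicot Require Import Coquelicot.

Open Scope R_scope.

(* Euler's integral: this is the Gamma function for [z > 0] only; it is not the
   analytic continuation to negative non-integers.  The integral is improper
   at both ends, since [t ^ (z - 1)] is unbounded near 0 when [z < 1]. *)
Definition Gamma (z : R) : R :=
  RInt_gen (fun t : R => exp (- t) * Rpower t (z - 1))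
           (at_right 0) (Rbar_locally p_infty).

(* Improper at 0, so that it is the right value for every [a > 0], [x > 0]. *)
Definition lower_gamma (a x : R) : R :=
  RInt_gen (fun u : R => exp (- u) * Rpower u (a - 1)) (at_right 0) (at_point x).

(* Meaningful for [x > 0] (as [Rpower 0 y = 1]) and, because of [Gamma], for
   [nu > - 3 / 2]. *)
Definition struveL (nu x : R) : R :=
  Series (fun k : nat =>
    Rpower (x / 2) (nu + 2 * INR k + 1)
    / (Gamma (INR k + 3 / 2) * Gamma (INR k + nu + 3 / 2))).

(* A proper Riemann integral suffices: for [nu > - 1 / 2] the integrand is
   continuous and bounded on (0, x], being [O (u ^ (2 * nu + 1))] at 0; its
   value at the single point 0 is a junk value and does not matter. *)
Definition struve_integral (beta nu x : R) : R :=
  RInt (fun u : R => exp (- beta * u) * Rpower u nu * struveL nu u) 0 x.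

(* Main.v *)
Require Import Defs.
From Stdlib Require Import Reals Lra.
From Coquelicot Require Import Coquelicot.

Open Scope R_scope.

(** Write [J = e^(-beta x) x^nu L_nu(x)] for the integrand,
    [F = e^(-beta x) x^nu L_(nu+1)(x)], [m = nu + 1/2] and [I] for the integral
    of [J] from [0] to [x].  The derivatives of the Struve functions give
    [F' = J - (beta + 1/x) F], so an inequality [I < Psi F] follows, by comparing
    increments from [0], from the pointwise inequality [J < (Psi F)'], and this
    one is a statement on the ratio [h = L_(nu+1) / L_nu] only
    ([struve_integral_increment]).  Two bounds on [h] are enough:
    [h <= x / (2 nu + 3)], visible on the power series ([struveL_ratio_le]), and
    [h < x / (x + m)], because the right-hand side is a supersolution of the
    Riccati equation of [h] ([struveL_ratio_lt]).

    Upper bounds.  If [nu >= 1/2], then [m >= 1] and both ratio bounds together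
    show [J < C F'] for every [x] as soon as
    [C >= (2 nu + 3) / ((2 nu + 1) (1 - beta))].  If [nu < 1/2], the inequality
    [J < C F'] fails for moderate [x] when [beta] is close to 1, but it holds
    beyond an explicit point [xs].  Before [xs] the bound
    [I < (2 + 2 x / m) F], with a coefficient depending on [x], is strong enough:
    its coefficient only reaches [C] after [xs].  The term
    [sqrt (2 (2 nu + 3))] is what makes the two ranges overlap, and it is at most
    [2 sqrt 2] exactly when [nu <= 1/2], whence the second constant.

    Lower bound.  From [L_nu' = L_(nu+1) + (nu / x) L_nu + t], where [t] is the
    inhomogeneous term of the Struve recurrence, [J] is the integral of
    [- beta J + F + (2 nu / x) J + e^(-beta x) x^nu t].  Since [L_(nu+1) < L_nu < L_(nu-1)],
    the second term is below [J] and the third below [2 nu] times the integrand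
    of order [nu - 1], whose integral is controlled by the upper bound at
    [nu - 1]; the last one integrates to the incomplete gamma term
    ([wstruve_lt_integrals]).  The coefficient of [t] contains
    [1 / (2 Gamma (3/2))], which has to be compared with [1 / sqrt PI]; this is
    where the Gaussian integral enters ([Gamma_three_half_ge]). *)

(** * Real powers and improper integrals over the half-line *)

Lemma locally_pos (x : R) : 0 < x -> locally x (fun t => 0 < t).
Proof. apply (open_gt 0). Qed.

Lemma is_derive_Rpower (p x : R) :
  0 < x -> is_derive (fun u => Rpower u p) x (p / x * Rpower x p).
Proof.
  intros Hx. unfold Rpower. auto_derive; [exact Hx|]. field. lra.
Qed.

Lemma exp_le_compat (x y : R) : x <= y -> exp x <= exp y.
Proof.
  intros [H| ->]; [apply Rlt_le, exp_increasing, H|apply Rle_refl].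
Qed.

Lemma continuous_of_is_derive (f : R -> R) (x l : R) :
  is_derive f x l -> continuous f x.
Proof.
  intros H. apply (ex_derive_continuous f x). exists l. exact H.
Qed.

Lemma ex_RInt_continuous_pos (f : R -> R) (a b : R) :
  (forall t, 0 < t -> continuous f t) -> 0 < a -> 0 < b -> ex_RInt f a b.
Proof.
  intros Hc Ha Hb. apply (ex_RInt_continuous (V := R_CompleteNormedModule)).
  intros t [Ht _]. apply Hc. apply Rlt_le_trans with (2 := Ht).
  now apply Rmin_glb_lt.
Qed.

(** The integrals over compact subintervals grow with the subinterval, so they
    tend to their supremum. *)
Lemma is_RInt_gen_of_bounded (f : R -> R) (B : R) :
  (forall t, 0 < t -> continuous f t) ->
  (forall t, 0 < t -> 0 <= f t) ->
  (forall a b, 0 < a -> a <= b -> RInt f a b <= B) ->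
  exists l : R,
    is_RInt_gen f (at_right 0) (Rbar_locally p_infty) l /\
    (forall a b, 0 < a -> a <= b -> RInt f a b <= l).
Proof.
  intros Hc Hp HB.
  set (E := fun y => exists a b, 0 < a /\ a <= b /\ y = RInt f a b).
  destruct (completeness E) as [l [Hub Hlub]].
  { exists B. intros y (a & b & Ha & Hab & ->). now apply HB. }
  { exists (RInt f 1 1). exists 1, 1. repeat split; lra. }
  assert (Hle : forall a b, 0 < a -> a <= b -> RInt f a b <= l).
  { intros a b Ha Hab. apply Hub. now exists a, b. }
  exists l. split; [|exact Hle].
  intros P [eps HP].
  assert (Hex : exists a b, 0 < a /\ a <= b /\ l - eps < RInt f a b).
  { apply Classical_Prop.NNPP. intros Hn.
    assert (H : is_upper_bound E (l - eps)).
    { intros y (a & b & Ha & Hab & ->).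
      apply Rnot_lt_le. intros Hlt. apply Hn. now exists a, b. }
    specialize (Hlub _ H). pose proof (cond_pos eps). lra. }
  destruct Hex as (a0 & b0 & Ha0 & Hab0 & Hlt).
  unfold filtermapi.
  apply (Filter_prod (at_right 0) (Rbar_locally p_infty) _
           (fun a => 0 < a < a0) (fun b => b0 < b)).
  - exists (mkposreal a0 Ha0). intros y Hy Hy0. split; [exact Hy0|].
    unfold ball in Hy; simpl in Hy; unfold AbsRing_ball, abs, minus, plus, opp in Hy;
    simpl in Hy. apply Rabs_def2 in Hy. lra.
  - exists b0. intros y Hy. exact Hy.
  - intros a b Ha Hb. simpl. exists (RInt f a b). split.
    + apply (RInt_correct (V := R_CompleteNormedModule)).
      apply ex_RInt_continuous_pos; [exact Hc| |]; lra.
    + apply HP. unfold ball; simpl; unfold AbsRing_ball, abs, minus, plus, opp; simpl.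
      assert (H1 : RInt f a b = RInt f a a0 + RInt f a0 b0 + RInt f b0 b).
      { rewrite <- (RInt_Chasles (V := R_CompleteNormedModule) f a b0 b);
          try (apply ex_RInt_continuous_pos; [exact Hc| |]; lra).
        rewrite <- (RInt_Chasles (V := R_CompleteNormedModule) f a a0 b0);
          try (apply ex_RInt_continuous_pos; [exact Hc| |]; lra).
        reflexivity. }
      assert (H2 : 0 <= RInt f a a0).
      { apply RInt_ge_0; [lra| |].
        - apply ex_RInt_continuous_pos; [exact Hc| |]; lra.
        - intros t Ht. apply Hp. lra. }
      assert (H3 : 0 <= RInt f b0 b).
      { apply RInt_ge_0; [lra| |].
        - apply ex_RInt_continuous_pos; [exact Hc| |]; lra.
        - intros t Ht. apply Hp. lra. }
      assert (H4 : RInt f a b <= l) by (apply Hle; lra).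
      apply Rabs_def1; pose proof (cond_pos eps); lra.
Qed.

Lemma is_lim_seq_INR_succ : is_lim_seq (fun k => INR k + 1) p_infty.
Proof.
  apply (is_lim_seq_plus INR (fun _ => 1) p_infty 1 p_infty).
  - apply is_lim_seq_INR.
  - apply is_lim_seq_const.
  - reflexivity.
Qed.

(** Reduces limits along both ends of the half-line to limits of sequences,
    where the usual calculus of limits applies. *)
Lemma is_lim_seq_RInt_gen (f : R -> R) (l : R) :
  is_RInt_gen f (at_right 0) (Rbar_locally p_infty) l ->
  is_lim_seq (fun k => RInt f (/ (INR k + 1)) (INR k + 1)) l.
Proof.
  intros H P HP. destruct (H P HP) as [Q S HQ HS HQS].
  pose proof (is_lim_seq_INR_succ : filterlim (fun k : nat => INR k + 1) eventually (Rbar_locally p_infty)) as Hinf.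
  assert (H0 : filterlim (fun k : nat => / (INR k + 1)) eventually (at_right 0)).
  { apply (filterlim_comp _ _ _ _ Rinv _ _ _ Hinf).
    intros A [e HA]. exists (/ e). intros t Ht.
    assert (0 < / e) by (apply Rinv_0_lt_compat, cond_pos).
    apply HA.
    - unfold ball; simpl; unfold AbsRing_ball, abs, minus, plus, opp; simpl.
      replace (/ t + - 0) with (/ t) by ring.
      rewrite Rabs_pos_eq by (apply Rlt_le, Rinv_0_lt_compat; lra).
      rewrite <- (Rinv_inv e). apply Rinv_lt_contravar; [apply Rmult_lt_0_compat|]; lra.
    - apply Rinv_0_lt_compat; lra. }
  unfold filtermap.
  assert (ES : eventually (fun k => S (INR k + 1))) by exact (Hinf _ HS).
  assert (EQ : eventually (fun k => Q (/ (INR k + 1)))) by exact (H0 _ HQ).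
  generalize (filter_and _ _ ES EQ). apply filter_imp.
  intros k [HSk HQk]. destruct (HQS (/ (INR k + 1)) (INR k + 1) HQk HSk) as [y [Hy HPy]]. simpl in Hy.
  now rewrite (is_RInt_unique _ _ _ _ Hy).
Qed.

(** [p ln t] is at most [c ln t = c ln (t / (2 c)) + c ln (2 c)] with
    [c = max p 1], and [ln y <= y]. *)
Lemma Rpower_le_exp_half (p : R) :
  exists K, 0 < K /\ forall t, 1 <= t -> Rpower t p <= K * exp (t / 2).
Proof.
  set (c := Rmax p 1).
  assert (Hc : p <= c /\ 1 <= c) by (split; [apply Rmax_l | apply Rmax_r]).
  exists (exp (c * ln (2 * c))). split; [apply exp_pos|].
  intros t Ht. unfold Rpower. rewrite <- exp_plus. apply exp_le_compat.
  assert (Hln0 : 0 <= ln t).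
  { rewrite <- ln_1. apply ln_le; lra. }
  assert (Hq : 0 < t / (2 * c)) by (apply Rdiv_lt_0_compat; lra).
  assert (Hln : ln t = ln (t / (2 * c)) + ln (2 * c)).
  { rewrite <- ln_mult; [|exact Hq|lra]. f_equal. field. lra. }
  assert (Hle : ln (t / (2 * c)) <= t / (2 * c)).
  { pose proof (exp_ineq1_le (ln (t / (2 * c)))) as H. rewrite exp_ln in H by exact Hq. lra. }
  apply Rle_trans with (c * ln t).
  { apply Rmult_le_compat_r; lra. }
  rewrite Hln, Rmult_plus_distr_l.
  apply Rle_trans with (c * (t / (2 * c)) + c * ln (2 * c)).
  { apply Rplus_le_compat_r, Rmult_le_compat_l; lra. }
  apply Req_le. field. lra.
Qed.

(** * Euler's integral *)

Definition gamma_integrand (z t : R) : R := exp (- t) * Rpower t (z - 1).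

Lemma gamma_integrand_pos (z t : R) : 0 < gamma_integrand z t.
Proof. apply Rmult_lt_0_compat; apply exp_pos. Qed.

Lemma continuous_gamma_integrand (z t : R) :
  0 < t -> continuous (gamma_integrand z) t.
Proof.
  intros Ht. unfold gamma_integrand.
  apply (continuous_mult (fun t => exp (- t)) (fun t => Rpower t (z - 1))).
  - apply (ex_derive_continuous (fun t => exp (- t))). auto_derive. exact I.
  - apply (continuous_of_is_derive _ _ _ (is_derive_Rpower (z - 1) t Ht)).
Qed.

(** Compare with [t^(z-1)] on [(0, 1]] and with a multiple of [e^(-t/2)] beyond. *)
Lemma RInt_gamma_integrand_bounded (z : R) : 0 < z ->
  exists B, forall a b, 0 < a -> a <= b -> RInt (gamma_integrand z) a b <= B.
Proof.
  intros Hz. destruct (Rpower_le_exp_half (z - 1)) as (K & HK & HKle).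
  assert (Hex : forall a b, 0 < a -> 0 < b -> ex_RInt (gamma_integrand z) a b).
  { intros. apply ex_RInt_continuous_pos; auto. apply continuous_gamma_integrand. }
  assert (Hsmall : forall a, 0 < a -> a <= 1 -> RInt (gamma_integrand z) a 1 <= / z).
  { intros a Ha Ha1.
    assert (HI : is_RInt (fun t => Rpower t (z - 1)) a 1
                   (minus (Rpower 1 z / z) (Rpower a z / z))).
    { apply (is_RInt_derive (fun t => Rpower t z / z)).
      - intros t Ht. rewrite Rmin_left in Ht by lra.
        replace (Rpower t (z - 1)) with (z / t * Rpower t z * / z).
        2:{ unfold Rminus. rewrite Rpower_plus, Rpower_Ropp, Rpower_1 by lra. field. lra. }
        apply (is_derive_ext (fun t => Rpower t z * / z)); [reflexivity|].
        apply (is_derive_scal_l (V := R_NormedModule)). apply is_derive_Rpower. lra.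
      - intros t Ht. rewrite Rmin_left in Ht by lra.
        apply (continuous_of_is_derive _ _ _ (is_derive_Rpower (z - 1) t ltac:(lra))). }
    apply Rle_trans with (RInt (fun t => Rpower t (z - 1)) a 1).
    - apply RInt_le; [lra|apply Hex; lra|eexists; exact HI|].
      intros t Ht. unfold gamma_integrand.
      rewrite <- (Rmult_1_l (Rpower t (z - 1))) at 2.
      apply Rmult_le_compat_r; [apply Rlt_le, exp_pos|].
      rewrite <- exp_0. apply exp_le_compat. lra.
    - rewrite (is_RInt_unique _ _ _ _ HI). unfold minus, plus, opp; simpl.
      assert (0 < Rpower a z / z) by (apply Rdiv_lt_0_compat; [apply exp_pos|exact Hz]).
      replace (Rpower 1 z) with 1.
      2:{ unfold Rpower. rewrite ln_1, Rmult_0_r, exp_0. reflexivity. }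
      unfold Rdiv at 1. lra. }
  assert (Hlarge : forall b, 1 <= b -> RInt (gamma_integrand z) 1 b <= 2 * K).
  { intros b Hb.
    assert (HI : is_RInt (fun t => K * exp (- (t / 2))) 1 b
                   (minus (- (2 * K) * exp (- (b / 2))) (- (2 * K) * exp (- (1 / 2))))).
    { apply (is_RInt_derive (fun t => - (2 * K) * exp (- (t / 2)))).
      - intros t _. auto_derive; [exact I|]. unfold Rdiv. field.
      - intros t _. apply (ex_derive_continuous (fun t => K * exp (- (t / 2)))).
        auto_derive. exact I. }
    apply Rle_trans with (RInt (fun t => K * exp (- (t / 2))) 1 b).
    - apply RInt_le; [lra|apply Hex; lra|eexists; exact HI|].
      intros t Ht. unfold gamma_integrand.
      apply Rle_trans with (exp (- t) * (K * exp (t / 2))).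
      + apply Rmult_le_compat_l; [apply Rlt_le, exp_pos|]. apply HKle. lra.
      + replace (- (t / 2)) with (- t + t / 2) by field. rewrite exp_plus. lra.
    - rewrite (is_RInt_unique _ _ _ _ HI). unfold minus, plus, opp; simpl.
      assert (0 < K * exp (- (b / 2))) by (apply Rmult_lt_0_compat; [lra|apply exp_pos]).
      pose proof (exp_le_compat (- (1 / 2)) 0 ltac:(lra)) as He. rewrite exp_0 in He.
      assert (K * exp (- (1 / 2)) <= K * 1) by (apply Rmult_le_compat_l; lra).
      lra. }
  exists (/ z + 2 * K). intros a b Ha Hab.
  assert (Hpos : forall a b, 0 < a -> a <= b -> 0 <= RInt (gamma_integrand z) a b).
  { intros c d Hc Hcd. apply RInt_ge_0; [lra|apply Hex; lra|].
    intros t _. apply Rlt_le, gamma_integrand_pos. }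
  set (a' := Rmin a 1). set (b' := Rmax b 1).
  assert (Ha' : 0 < a' <= a /\ a' <= 1).
  { unfold a', Rmin. destruct (Rle_dec a 1); lra. }
  assert (Hb' : b <= b' /\ 1 <= b').
  { unfold b', Rmax. destruct (Rle_dec b 1); lra. }
  assert (Hch : forall c d e, 0 < c -> 0 < d -> 0 < e ->
     RInt (gamma_integrand z) c d + RInt (gamma_integrand z) d e
     = RInt (gamma_integrand z) c e).
  { intros c d e Hc Hd He.
    apply (RInt_Chasles (V := R_CompleteNormedModule) (gamma_integrand z) c d e);
      apply Hex; lra. }
  pose proof (Hch a' a b ltac:(lra) ltac:(lra) ltac:(lra)).
  pose proof (Hch a' b b' ltac:(lra) ltac:(lra) ltac:(lra)).
  pose proof (Hch a' 1 b' ltac:(lra) ltac:(lra) ltac:(lra)).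
  pose proof (Hpos a' a ltac:(lra) ltac:(lra)).
  pose proof (Hpos b b' ltac:(lra) ltac:(lra)).
  pose proof (Hsmall a' ltac:(lra) ltac:(lra)).
  pose proof (Hlarge b' ltac:(lra)).
  lra.
Qed.

Lemma Gamma_correct (z : R) : 0 < z ->
  is_lim_seq (fun k => RInt (gamma_integrand z) (/ (INR k + 1)) (INR k + 1)) (Gamma z)
  /\ (forall a b, 0 < a -> a <= b -> RInt (gamma_integrand z) a b <= Gamma z).
Proof.
  intros Hz. destruct (RInt_gamma_integrand_bounded z Hz) as [B HB].
  destruct (is_RInt_gen_of_bounded (gamma_integrand z) B) as (l & Hl & Hle).
  - apply continuous_gamma_integrand.
  - intros t _. apply Rlt_le, gamma_integrand_pos.
  - exact HB.
  - assert (HG : Gamma z = l).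
    { exact (is_RInt_gen_unique (gamma_integrand z) l Hl). }
    rewrite HG. split; [now apply is_lim_seq_RInt_gen|exact Hle].
Qed.

Lemma Gamma_pos (z : R) : 0 < z -> 0 < Gamma z.
Proof.
  intros Hz. destruct (Gamma_correct z Hz) as [_ H].
  apply Rlt_le_trans with (2 := H 1 2 ltac:(lra) ltac:(lra)).
  apply RInt_gt_0; [lra| |].
  - intros t _. apply gamma_integrand_pos.
  - intros t Ht. apply continuous_gamma_integrand. lra.
Qed.

Lemma RInt_gamma_integrand_succ (z a b : R) : 0 < a -> 0 < b ->
  RInt (gamma_integrand (z + 1)) a b
  = z * RInt (gamma_integrand z) a b
    + (exp (- a) * Rpower a z - exp (- b) * Rpower b z).
Proof.
  intros Ha Hb.
  assert (Hcont : forall z, ex_RInt (gamma_integrand z) a b).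
  { intros w. apply ex_RInt_continuous_pos; auto. apply continuous_gamma_integrand. }
  assert (HI : is_RInt (fun t => z * gamma_integrand z t - gamma_integrand (z + 1) t) a b
                 (minus (exp (- b) * Rpower b z) (exp (- a) * Rpower a z))).
  { apply (is_RInt_derive (fun t => exp (- t) * Rpower t z)).
    - intros t Ht.
      assert (H0 : 0 < t).
      { apply Rlt_le_trans with (2 := proj1 Ht). now apply Rmin_glb_lt. }
      unfold gamma_integrand. replace (z + 1 - 1) with z by ring.
      unfold Rpower. auto_derive; [exact H0|].
      replace ((z - 1) * ln t) with (z * ln t + - ln t) by ring.
      rewrite exp_plus, (exp_Ropp (ln t)), exp_ln by exact H0. field. lra.
    - intros t Ht.
      assert (H0 : 0 < t).
      { apply Rlt_le_trans with (2 := proj1 Ht). now apply Rmin_glb_lt. }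
      apply (continuous_minus (fun t => z * gamma_integrand z t) (gamma_integrand (z + 1))).
      + apply (continuous_scal_r z (gamma_integrand z)). now apply continuous_gamma_integrand.
      + now apply continuous_gamma_integrand. }
  apply (is_RInt_unique (V := R_CompleteNormedModule)) in HI.
  rewrite (RInt_minus (V := R_CompleteNormedModule) (fun t => z * gamma_integrand z t)) in HI.
  - rewrite (RInt_scal (V := R_CompleteNormedModule) (gamma_integrand z)) in HI by apply Hcont.
    unfold minus, plus, opp, scal in HI; simpl in HI. unfold mult in HI; simpl in HI. lra.
  - apply (ex_RInt_scal (V := R_NormedModule) (gamma_integrand z)). apply Hcont.
  - apply Hcont.
Qed.

Lemma is_lim_seq_exp_mul_Rpower (z : R) :
  is_lim_seq (fun k => exp (- (INR k + 1)) * Rpower (INR k + 1) z) 0.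
Proof.
  destruct (Rpower_le_exp_half z) as (K & HK & HKle).
  apply is_lim_seq_le_le with (u := fun _ => 0) (w := fun k => K * exp (- ((INR k + 1) / 2))).
  - intros k. pose proof (pos_INR k) as Hk. split.
    + apply Rlt_le, Rmult_lt_0_compat; apply exp_pos.
    + apply Rle_trans with (exp (- (INR k + 1)) * (K * exp ((INR k + 1) / 2))).
      * apply Rmult_le_compat_l; [apply Rlt_le, exp_pos|]. apply HKle. lra.
      * replace (- ((INR k + 1) / 2)) with (- (INR k + 1) + (INR k + 1) / 2) by field.
        rewrite exp_plus. lra.
  - apply is_lim_seq_const.
  - replace (Finite 0) with (Rbar_mult K 0) by (simpl; f_equal; ring).
    apply is_lim_seq_scal_l.
    apply (is_lim_comp_seq exp _ m_infty 0).
    + apply is_lim_exp_m.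
    + exists 0%nat. discriminate.
    + apply (is_lim_seq_ext (fun k => (- / 2) * (INR k + 1))); [intros; field|].
      replace m_infty with (Rbar_mult (- / 2) p_infty).
      2:{ apply is_Rbar_mult_unique, is_Rbar_mult_sym, is_Rbar_mult_p_infty_neg. simpl. lra. }
      apply is_lim_seq_scal_l. apply is_lim_seq_INR_succ.
Qed.

Lemma Gamma_succ (z : R) : 0 < z -> Gamma (z + 1) = z * Gamma z.
Proof.
  intros Hz. destruct (Gamma_correct z Hz) as [H _].
  destruct (Gamma_correct (z + 1) ltac:(lra)) as [H1 _].
  set (u := fun k => RInt (gamma_integrand z) (/ (INR k + 1)) (INR k + 1)) in H.
  assert (H0 : is_lim_seq (fun k => exp (- / (INR k + 1)) * Rpower (/ (INR k + 1)) z) 0).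
  { apply is_lim_seq_le_le with (u := fun _ => 0) (w := fun k => exp (- z * ln (INR k + 1))).
    - intros k. pose proof (pos_INR k) as Hk. split.
      + apply Rlt_le, Rmult_lt_0_compat; apply exp_pos.
      + unfold Rpower. rewrite ln_Rinv by lra.
        replace (z * - ln (INR k + 1)) with (- z * ln (INR k + 1)) by ring.
        rewrite <- (Rmult_1_l (exp (- z * ln (INR k + 1)))) at 2.
        apply Rmult_le_compat_r; [apply Rlt_le, exp_pos|].
        assert (Hi : 0 < / (INR k + 1)) by (apply Rinv_0_lt_compat; lra).
        pose proof (exp_le_compat (- / (INR k + 1)) 0 ltac:(lra)) as He.
        now rewrite exp_0 in He.
    - apply is_lim_seq_const.
    - apply (is_lim_comp_seq exp _ m_infty 0).
      + apply is_lim_exp_m.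
      + exists 0%nat. discriminate.
      + replace m_infty with (Rbar_mult (- z) p_infty).
        2:{ apply is_Rbar_mult_unique, is_Rbar_mult_sym, is_Rbar_mult_p_infty_neg. simpl. lra. }
        apply is_lim_seq_scal_l.
        apply (is_lim_comp_seq ln _ p_infty p_infty).
        * apply is_lim_ln_p.
        * exists 0%nat. discriminate.
        * apply is_lim_seq_INR_succ. }
  assert (H2 : is_lim_seq
     (fun k => RInt (gamma_integrand (z + 1)) (/ (INR k + 1)) (INR k + 1)) (z * Gamma z + (0 - 0))).
  { apply is_lim_seq_ext with
      (u := fun k => z * u k + (exp (- / (INR k + 1)) * Rpower (/ (INR k + 1)) z
                           - exp (- (INR k + 1)) * Rpower (INR k + 1) z)).
    - intros k. pose proof (pos_INR k) as Hk. unfold u.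
      rewrite RInt_gamma_integrand_succ; [reflexivity|apply Rinv_0_lt_compat; lra|lra].
    - apply (is_lim_seq_plus' (fun k => z * u k)).
      + apply (is_lim_seq_scal_l u z (Gamma z)). exact H.
      + apply is_lim_seq_minus'; [exact H0|apply is_lim_seq_exp_mul_Rpower]. }
  pose proof (is_lim_seq_unique _ _ H1) as E1.
  pose proof (is_lim_seq_unique _ _ H2) as E2.
  rewrite E1 in E2. injection E2. intros E. lra.
Qed.

(** * The Gaussian integral and Gamma at 3/2 *)

Definition gauss (t : R) : R := exp (- t ^ 2).

Definition gauss_int (x : R) : R := RInt gauss 0 x.

Lemma continuous_gauss (t : R) : continuous gauss t.
Proof.
  apply (ex_derive_continuous gauss). unfold gauss. auto_derive. exact I.
Qed.

Lemma ex_RInt_gauss (a b : R) : ex_RInt gauss a b.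
Proof.
  apply (ex_RInt_continuous (V := R_CompleteNormedModule)).
  intros t _. apply continuous_gauss.
Qed.

Lemma is_derive_gauss_int (x : R) : is_derive gauss_int x (gauss x).
Proof.
  apply (is_derive_RInt (V := R_NormedModule) gauss gauss_int 0 x).
  - apply filter_forall. intros y. apply (RInt_correct (V := R_CompleteNormedModule)).
    apply ex_RInt_gauss.
  - apply continuous_gauss.
Qed.

Definition gauss_kernel (x t : R) : R := exp (- x ^ 2 * (1 + t ^ 2)) / (1 + t ^ 2).

Lemma one_plus_sqr_pos (t : R) : 0 < 1 + t ^ 2.
Proof. pose proof (pow2_ge_0 t). lra. Qed.

Lemma is_derive_gauss_kernel (x t : R) :
  is_derive (fun u => gauss_kernel u t) x (- 2 * x * exp (- x ^ 2 * (1 + t ^ 2))).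
Proof.
  pose proof (one_plus_sqr_pos t) as Ht. unfold gauss_kernel.
  auto_derive; [lra|]. simpl in *. field. lra.
Qed.

Lemma continuous_gauss_kernel (x t : R) : continuous (gauss_kernel x) t.
Proof.
  pose proof (one_plus_sqr_pos t) as Ht.
  apply (ex_derive_continuous (gauss_kernel x)). unfold gauss_kernel. auto_derive. simpl in *. lra.
Qed.

Lemma is_derive_RInt_gauss_kernel (x : R) :
  is_derive (fun x => RInt (gauss_kernel x) 0 1) x (- 2 * gauss x * gauss_int x).
Proof.
  replace (- 2 * gauss x * gauss_int x)
    with (RInt (fun t => Derive (fun u => gauss_kernel u t) x) 0 1).
  - apply (is_derive_RInt_param gauss_kernel 0 1 x).
    + apply filter_forall. intros y t _. eexists. apply is_derive_gauss_kernel.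
    + intros t _.
      apply continuity_2d_pt_ext with (f := fun u v => (- 2 * u) * exp (- u ^ 2 * (1 + v ^ 2))).
      { intros u v. symmetry. apply is_derive_unique, is_derive_gauss_kernel. }
      apply continuity_2d_pt_mult.
      * apply continuity_2d_pt_mult; [apply continuity_2d_pt_const|apply continuity_2d_pt_id1].
      * apply (continuity_1d_2d_pt_comp exp (fun u v => - u ^ 2 * (1 + v ^ 2))).
        { apply derivable_continuous_pt, derivable_pt_exp. }
        apply continuity_2d_pt_mult.
        -- apply (continuity_1d_2d_pt_comp (fun u => - u ^ 2) (fun u v => u)).
           ++ apply continuity_pt_filterlim.
              apply (ex_derive_continuous (fun u => - u ^ 2)). auto_derive. exact I.
           ++ apply continuity_2d_pt_id1.
        -- apply (continuity_1d_2d_pt_comp (fun u => 1 + u ^ 2) (fun u v => v)).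
           ++ apply continuity_pt_filterlim.
              apply (ex_derive_continuous (fun u => 1 + u ^ 2)). auto_derive. exact I.
           ++ apply continuity_2d_pt_id2.
    + apply filter_forall. intros y.
      apply (ex_RInt_continuous (V := R_CompleteNormedModule)).
      intros t _. apply continuous_gauss_kernel.
  - rewrite (RInt_ext _ (fun t => (- 2 * gauss x) * (x * gauss (x * t + 0)))).
    + rewrite (RInt_scal (V := R_CompleteNormedModule) (fun t => x * gauss (x * t + 0))).
      * pose proof (RInt_comp_lin (V := R_CompleteNormedModule) gauss x 0 0 1
                      (ex_RInt_gauss _ _)) as E.
        rewrite Rmult_0_r, Rmult_1_r, !Rplus_0_r in E.
        unfold gauss_int. rewrite <- E. reflexivity.
      * apply (ex_RInt_continuous (V := R_CompleteNormedModule)).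
        intros t _. apply (ex_derive_continuous (fun t => x * gauss (x * t + 0))).
        unfold gauss. auto_derive. exact I.
    + intros t _. etransitivity; [apply is_derive_unique, is_derive_gauss_kernel|].
      unfold gauss.
      replace (- x ^ 2 * (1 + t ^ 2)) with (- x ^ 2 + - (x * t + 0) ^ 2) by ring.
      rewrite exp_plus.
      match goal with |- ?a = ?b => change (@eq R a b) end. ring.
Qed.

(** The classical proof by a parameter: the derivatives of both terms cancel, and
    at [0] the second one is the integral of [1 / (1 + t^2)], that is [atan 1]. *)
Lemma gauss_int_sqr_add (x : R) : 0 < x ->
  gauss_int x ^ 2 + RInt (gauss_kernel x) 0 1 = PI / 4.
Proof.
  intros Hx.
  transitivity (gauss_int 0 ^ 2 + RInt (gauss_kernel 0) 0 1).
  - symmetry.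
    apply (eq_is_derive (V := R_NormedModule)
             (fun x => gauss_int x ^ 2 + RInt (gauss_kernel x) 0 1) 0 x); [|exact Hx].
    intros t _.
    replace (@zero R_NormedModule) with
      (plus (INR 2 * gauss t * gauss_int t ^ pred 2) (- 2 * gauss t * gauss_int t)).
    2:{ unfold plus, zero; simpl. ring. }
    apply (is_derive_plus (V := R_NormedModule) (fun x => gauss_int x ^ 2)).
    + apply (is_derive_pow gauss_int 2 t (gauss t)). apply is_derive_gauss_int.
    + apply is_derive_RInt_gauss_kernel.
  - unfold gauss_int at 1. rewrite RInt_point.
    unfold zero; simpl.
    assert (HI : is_RInt (gauss_kernel 0) 0 1 (minus (atan 1) (atan 0))).
    { apply (is_RInt_ext (fun t => / (1 + t ^ 2))).
      { intros t _. unfold gauss_kernel.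
        replace (- 0 ^ 2 * (1 + t ^ 2)) with 0 by ring. rewrite exp_0.
        symmetry. apply Rmult_1_l. }
      apply (is_RInt_derive atan).
      - intros t _. pose proof (one_plus_sqr_pos t). auto_derive; [exact I|].
        simpl in *. unfold Rsqr. field. lra.
      - intros t _. pose proof (one_plus_sqr_pos t).
        apply (ex_derive_continuous (fun t => / (1 + t ^ 2))). auto_derive. simpl in *. lra. }
    rewrite (is_RInt_unique _ _ _ _ HI). unfold minus, plus, opp; simpl.
    rewrite atan_1, atan_0. ring.
Qed.

Lemma gauss_int_sqr_ge (x : R) : 0 < x -> PI / 4 - gauss x <= gauss_int x ^ 2.
Proof.
  intros Hx. rewrite <- (gauss_int_sqr_add x Hx).
  assert (H : RInt (gauss_kernel x) 0 1 <= RInt (fun _ => gauss x) 0 1).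
  { apply RInt_le; [lra| |apply ex_RInt_const|].
    - apply (ex_RInt_continuous (V := R_CompleteNormedModule)).
      intros t _. apply continuous_gauss_kernel.
    - intros t _. unfold gauss_kernel, gauss. pose proof (one_plus_sqr_pos t).
      apply Rle_div_l; [lra|].
      apply Rle_trans with (exp (- x ^ 2) * 1).
      + rewrite Rmult_1_r. apply exp_le_compat.
        pose proof (Rmult_le_pos _ _ (pow2_ge_0 x) (pow2_ge_0 t)). lra.
      + apply Rmult_le_compat_l; [apply Rlt_le, exp_pos|]. pose proof (pow2_ge_0 t). lra. }
  rewrite RInt_const in H. unfold scal in H; simpl in H. unfold mult in H; simpl in H. lra.
Qed.

(** Substitute [t = s^2] in Euler's integral to get the integral of
    [2 s^2 e^(-s^2)], then integrate by parts. *)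
Lemma Gamma_three_half_ge_gauss_int (x : R) : 0 < x ->
  gauss_int x - x * gauss x <= Gamma (3 / 2).
Proof.
  intros Hx. apply Rle_plus_epsilon. intros eps Heps.
  set (a := Rmin eps x).
  assert (Ha : 0 < a /\ a <= eps /\ a <= x).
  { repeat split; [now apply Rmin_glb_lt|apply Rmin_l|apply Rmin_r]. }
  assert (HG : RInt (gamma_integrand (3 / 2)) (a ^ 2) (x ^ 2) <= Gamma (3 / 2)).
  { apply Gamma_correct; [lra| |]. nra. apply pow_incr. lra. }
  rewrite <- (RInt_comp (V := R_CompleteNormedModule) (gamma_integrand (3 / 2))
                (fun s => s ^ 2) (fun s => 2 * s)) in HG.
  2:{ rewrite Rmin_left, Rmax_right by lra. intros s Hs. apply continuous_gamma_integrand. nra. }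
  2:{ rewrite Rmin_left, Rmax_right by lra. intros s Hs. split.
      - auto_derive; [exact I|]. simpl. ring.
      - apply (ex_derive_continuous (fun s => 2 * s)). auto_derive. exact I. }
  assert (HI : is_RInt (fun s => gauss s - 2 * s ^ 2 * gauss s) a x
                 (minus (x * gauss x) (a * gauss a))).
  { apply (is_RInt_derive (fun s => s * gauss s)).
    - intros s _. unfold gauss. auto_derive; [exact I|]. simpl. ring.
    - intros s _. apply (ex_derive_continuous (fun s => gauss s - 2 * s ^ 2 * gauss s)).
      unfold gauss. auto_derive. exact I. }
  assert (Hex : ex_RInt (fun s => 2 * s ^ 2 * gauss s) a x).
  { apply (ex_RInt_continuous (V := R_CompleteNormedModule)).
    intros s _. apply (ex_derive_continuous (fun s => 2 * s ^ 2 * gauss s)).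
    unfold gauss. auto_derive. exact I. }
  apply (is_RInt_unique (V := R_CompleteNormedModule)) in HI.
  rewrite (RInt_minus (V := R_CompleteNormedModule) gauss (fun s => 2 * s ^ 2 * gauss s)) in HI;
    [|apply ex_RInt_gauss|exact Hex].
  rewrite (RInt_ext _ (fun s => 2 * s ^ 2 * gauss s)) in HG.
  2:{ rewrite Rmin_left, Rmax_right by lra. intros s Hs.
      unfold gamma_integrand, gauss, scal; simpl; unfold mult; simpl.
      replace (3 / 2 - 1) with (/ 2) by field.
      rewrite Rpower_sqrt by nra.
      replace (s * (s * 1)) with (s * s) by ring. rewrite sqrt_square by lra. ring. }
  assert (Hsplit : gauss_int a + RInt gauss a x = gauss_int x).
  { apply (RInt_Chasles (V := R_CompleteNormedModule) gauss 0 a x); apply ex_RInt_gauss. }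
  assert (Hga : gauss_int a <= a).
  { apply Rle_trans with (RInt (fun _ => 1) 0 a).
    - apply RInt_le; [lra|apply ex_RInt_gauss|apply ex_RInt_const|].
      intros s _. unfold gauss. pose proof (exp_le_compat (- s ^ 2) 0) as He.
      rewrite exp_0 in He. apply He. pose proof (pow2_ge_0 s). lra.
    - rewrite RInt_const. unfold scal; simpl; unfold mult; simpl. lra. }
  assert (0 < a * gauss a) by (apply Rmult_lt_0_compat; [lra|apply exp_pos]).
  unfold minus, plus, opp in HI; simpl in HI, HG. lra.
Qed.

(** Take [x = 1 / d] in the two preceding lemmas and let [d] tend to [0]: since
    [gauss (1 / d) <= d^2], the error terms vanish. *)
Lemma Gamma_three_half_ge : sqrt PI / 2 <= Gamma (3 / 2).
Proof.
  set (G := Gamma (3 / 2)).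
  assert (HG : 0 < G) by (apply Gamma_pos; lra).
  assert (Hsq : PI / 4 <= G ^ 2).
  { apply Rle_plus_epsilon. intros eps Heps.
    set (d := Rmin 1 (eps / (2 * G + 2))).
    assert (Hd : 0 < d /\ d <= 1 /\ d <= eps / (2 * G + 2)).
    { repeat split; [apply Rmin_glb_lt; [lra|apply Rdiv_lt_0_compat; lra]|apply Rmin_l|apply Rmin_r]. }
    destruct Hd as (Hd0 & Hd1 & Hd2).
    apply Rle_div_r in Hd2; [|lra].
    assert (Hi : 0 < / d) by now apply Rinv_0_lt_compat.
    assert (Hg : gauss (/ d) <= d ^ 2).
    { unfold gauss. rewrite exp_Ropp. rewrite <- (Rinv_inv (d ^ 2)).
      apply Rinv_le_contravar; [apply Rinv_0_lt_compat; nra|].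
      rewrite <- pow_inv. pose proof (exp_ineq1_le ((/ d) ^ 2)). lra. }
    pose proof (exp_pos (- (/ d) ^ 2)) as Hg0. fold (gauss (/ d)) in Hg0.
    assert (Hdg : / d * gauss (/ d) <= d).
    { apply Rle_trans with (/ d * d ^ 2).
      - apply Rmult_le_compat_l; lra.
      - apply Req_le. field. lra. }
    pose proof (gauss_int_sqr_ge (/ d) Hi) as H1.
    pose proof (Gamma_three_half_ge_gauss_int (/ d) Hi) as H2. fold G in H2.
    assert (H3 : gauss_int (/ d) <= G + d) by lra.
    assert (H4 : 0 <= gauss_int (/ d)).
    { apply RInt_ge_0; [lra|apply ex_RInt_gauss|]. intros; apply Rlt_le, exp_pos. }
    assert (H5 : gauss_int (/ d) ^ 2 <= (G + d) ^ 2) by (apply pow_incr; lra).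
    nra. }
  apply Rsqr_incr_0_var; [|lra]. unfold Rsqr.
  pose proof (sqrt_sqrt PI (Rlt_le _ _ PI_RGT_0)). lra.
Qed.

(** * Power series, derivatives and ratio of modified Struve functions *)

(** The Euler operator [y d/dy + r] multiplies the coefficients by [k + r]; both
    recurrences for the Struve series are instances of this. *)
Lemma PSeries_euler (a : nat -> R) (r y : R) : CV_radius a = p_infty ->
  ex_pseries (fun k => (INR k + r) * a k) y /\
  y * PSeries (PS_derive a) y + r * PSeries a y = PSeries (fun k => (INR k + r) * a k) y.
Proof.
  intros Ha.
  assert (Hin : forall b, CV_radius b = p_infty -> ex_pseries b y).
  { intros b Hb. apply CV_radius_inside. rewrite Hb. exact I. }
  assert (E1 : ex_pseries (PS_incr_1 (PS_derive a)) y).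
  { apply ex_pseries_incr_1, Hin. now rewrite CV_radius_derive. }
  assert (E2 : ex_pseries (PS_scal r a) y).
  { apply ex_pseries_scal; [apply Rmult_comm|now apply Hin]. }
  assert (Hext : forall k, PS_plus (PS_incr_1 (PS_derive a)) (PS_scal r a) k
                           = (INR k + r) * a k).
  { intros k. unfold PS_plus, PS_scal, PS_incr_1, PS_derive, plus, scal; simpl.
    unfold mult; simpl. destruct k; unfold zero; simpl; ring. }
  split.
  - apply (ex_pseries_ext _ _ y Hext). now apply ex_pseries_plus.
  - rewrite <- (PSeries_ext _ _ y Hext), PSeries_plus by assumption.
    now rewrite PSeries_incr_1, PSeries_scal.
Qed.

Lemma PSeries_ge_0 (a : nat -> R) (y : R) :
  (forall k, 0 <= a k) -> 0 <= y -> ex_pseries a y -> 0 <= PSeries a y.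
Proof.
  intros Ha Hy Hex. unfold PSeries.
  rewrite <- (Rmult_0_l (Series (fun k => a k * y ^ k))).
  rewrite <- Series_scal_l.
  apply Series_le.
  - intros k. rewrite Rmult_0_l. split; [lra|].
    apply Rmult_le_pos; [apply Ha|now apply pow_le].
  - apply (ex_series_ext (fun k => scal (pow_n y k) (a k))); [|exact Hex].
    intros k. rewrite pow_n_pow. apply Rmult_comm.
Qed.

Definition struve_coef (n : R) (k : nat) : R :=
  / (Gamma (INR k + 3 / 2) * Gamma (INR k + n)).

Lemma struve_coef_pos (n : R) (k : nat) : 0 < n -> 0 < struve_coef n k.
Proof.
  intros Hn. pose proof (pos_INR k).
  apply Rinv_0_lt_compat, Rmult_lt_0_compat; apply Gamma_pos; lra.
Qed.

Lemma struve_coef_succ (n : R) (k : nat) : 0 < n ->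
  (INR k + n) * struve_coef (n + 1) k = struve_coef n k.
Proof.
  intros Hn. pose proof (pos_INR k) as Hk. unfold struve_coef.
  rewrite <- Rplus_assoc, Gamma_succ by lra.
  pose proof (Gamma_pos (INR k + 3 / 2) ltac:(lra)).
  pose proof (Gamma_pos (INR k + n) ltac:(lra)).
  field. repeat split; lra.
Qed.

Lemma struve_coef_shift (n : R) (k : nat) : 0 < n ->
  (INR (S k) + 1 / 2) * struve_coef n (S k) = struve_coef (n + 1) k.
Proof.
  intros Hn. pose proof (pos_INR k) as Hk. unfold struve_coef.
  rewrite S_INR.
  replace (INR k + 1 + 3 / 2) with (INR k + 3 / 2 + 1) by ring.
  replace (INR k + (n + 1)) with (INR k + 1 + n) by ring.
  rewrite Gamma_succ by lra.
  pose proof (Gamma_pos (INR k + 3 / 2) ltac:(lra)).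
  pose proof (Gamma_pos (INR k + 1 + n) ltac:(lra)).
  field. repeat split; lra.
Qed.

Lemma CV_radius_struve_coef (n : R) : 0 < n -> CV_radius (struve_coef n) = p_infty.
Proof.
  intros Hn. apply CV_radius_infinite_DAlembert.
  - intros k. apply Rgt_not_eq, struve_coef_pos, Hn.
  - apply is_lim_seq_le_le with (u := fun _ => 0) (w := fun k => / n * / (INR k + 1)).
    + intros k. split; [apply Rabs_pos|].
      pose proof (pos_INR k) as Hk.
      pose proof (struve_coef_pos n k Hn) as H0.
      pose proof (struve_coef_pos n (S k) Hn) as H1.
      rewrite Rabs_pos_eq by (apply Rlt_le, Rdiv_lt_0_compat; assumption).
      pose proof (struve_coef_shift n k Hn) as H2.
      pose proof (struve_coef_succ n k Hn) as H3.
      pose proof (struve_coef_pos (n + 1) k ltac:(lra)) as H4.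
      rewrite S_INR in H2.
      rewrite <- H3, <- H2. rewrite <- Rinv_mult.
      replace (struve_coef n (S k)
               / ((INR k + n) * ((INR k + 1 + 1 / 2) * struve_coef n (S k))))
        with (/ ((INR k + n) * (INR k + 1 + 1 / 2))) by (field; repeat split; lra).
      apply Rinv_le_contravar; [apply Rmult_lt_0_compat; lra|].
      apply Rmult_le_compat; lra.
    + apply is_lim_seq_const.
    + replace (Finite 0) with (Rbar_mult (/ n) (Rbar_inv p_infty)) by (simpl; f_equal; ring).
      apply is_lim_seq_scal_l. apply is_lim_seq_inv; [apply is_lim_seq_INR_succ|discriminate].
Qed.

(** The entire function with [L_nu(x) = (x/2)^(nu+1) s((x/2)^2)], where
    [n = nu + 3/2]. *)
Definition struve_series (n y : R) : R := PSeries (struve_coef n) y.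

Definition struve_series' (n y : R) : R := PSeries (PS_derive (struve_coef n)) y.

Lemma is_derive_struve_series (n y : R) : 0 < n ->
  is_derive (struve_series n) y (struve_series' n y).
Proof.
  intros Hn. apply is_derive_PSeries. rewrite CV_radius_struve_coef by exact Hn. exact I.
Qed.

Lemma ex_pseries_struve_coef (n y : R) : 0 < n -> ex_pseries (struve_coef n) y.
Proof.
  intros Hn. apply CV_radius_inside. rewrite CV_radius_struve_coef by exact Hn. exact I.
Qed.

Lemma struve_series_pos (n y : R) : 0 < n -> 0 <= y -> 0 < struve_series n y.
Proof.
  intros Hn Hy. unfold struve_series.
  rewrite PSeries_decr_1 by now apply ex_pseries_struve_coef.
  pose proof (struve_coef_pos n 0 Hn).
  assert (0 <= PSeries (PS_decr_1 (struve_coef n)) y).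
  { apply PSeries_ge_0; [|exact Hy|].
    - intros k. apply Rlt_le, struve_coef_pos, Hn.
    - apply CV_radius_inside. rewrite CV_radius_decr_1, CV_radius_struve_coef by exact Hn.
      exact I. }
  pose proof (Rmult_le_pos _ _ Hy H0). lra.
Qed.

Lemma struve_series'_ge_0 (n y : R) : 0 < n -> 0 <= y -> 0 <= struve_series' n y.
Proof.
  intros Hn Hy. apply PSeries_ge_0; [|exact Hy|].
  - intros k. apply Rmult_le_pos; [apply pos_INR|apply Rlt_le, struve_coef_pos, Hn].
  - apply CV_radius_inside. rewrite CV_radius_derive, CV_radius_struve_coef by exact Hn. exact I.
Qed.

(** Series form of [(x^nu L_nu)' = x^nu L_(nu-1)]. *)
Lemma struve_series_lower (n y : R) : 0 < n ->
  y * struve_series' (n + 1) y + n * struve_series (n + 1) y = struve_series n y.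
Proof.
  intros Hn. unfold struve_series, struve_series'.
  rewrite (proj2 (PSeries_euler (struve_coef (n + 1)) n y
                    (CV_radius_struve_coef (n + 1) ltac:(lra)))).
  apply PSeries_ext. intros k. now apply struve_coef_succ.
Qed.

(** Series form of [(x^(-nu) L_nu)' = x^(-nu) (L_(nu+1) + t)]: the Euler operator
    shifts the index, and its constant term is the inhomogeneous part. *)
Lemma struve_series_raise (n y : R) : 0 < n ->
  y * struve_series' n y + 1 / 2 * struve_series n y
  = / (2 * Gamma (3 / 2) * Gamma n) + y * struve_series (n + 1) y.
Proof.
  intros Hn. unfold struve_series, struve_series'.
  destruct (PSeries_euler (struve_coef n) (1 / 2) y (CV_radius_struve_coef n Hn)) as [Hex ->].
  rewrite PSeries_decr_1 by exact Hex.
  f_equal.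
  - unfold struve_coef. simpl. rewrite !Rplus_0_l.
    pose proof (Gamma_pos (3 / 2) ltac:(lra)). pose proof (Gamma_pos n Hn).
    field. repeat split; lra.
  - f_equal. apply PSeries_ext. intros k. now apply struve_coef_shift.
Qed.

Lemma struveL_eq (nu x : R) : 0 < x ->
  struveL nu x = Rpower (x / 2) (nu + 1) * struve_series (nu + 3 / 2) ((x / 2) ^ 2).
Proof.
  intros Hx. unfold struveL, struve_series, PSeries.
  rewrite <- Series_scal_l. apply Series_ext. intros k.
  replace (INR k + nu + 3 / 2) with (INR k + (nu + 3 / 2)) by ring.
  replace (nu + 2 * INR k + 1) with (nu + 1 + INR (2 * k)) by (rewrite mult_INR; simpl; ring).
  rewrite Rpower_plus, Rpower_pow, pow_mult by lra.
  unfold struve_coef, Rdiv. ring.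
Qed.

Lemma struveL_pos (nu x : R) : - (3 / 2) < nu -> 0 < x -> 0 < struveL nu x.
Proof.
  intros Hnu Hx. rewrite struveL_eq by exact Hx.
  apply Rmult_lt_0_compat; [apply exp_pos|].
  apply struve_series_pos; [lra|apply pow2_ge_0].
Qed.

Lemma Rpower_succ (x p : R) : 0 < x -> Rpower x (p + 1) = x * Rpower x p.
Proof.
  intros Hx. rewrite Rpower_plus, Rpower_1 by exact Hx. ring.
Qed.

Lemma is_derive_struveL_series (nu x : R) : - (3 / 2) < nu -> 0 < x ->
  is_derive (struveL nu) x
    (Rpower (x / 2) (nu + 1) * ((nu + 1) / x * struve_series (nu + 3 / 2) ((x / 2) ^ 2)
      + x / 2 * struve_series' (nu + 3 / 2) ((x / 2) ^ 2))).
Proof.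
  intros Hnu Hx.
  apply (is_derive_ext_loc
    (fun x => Rpower (x / 2) (nu + 1) * struve_series (nu + 3 / 2) ((x / 2) ^ 2))).
  { generalize (locally_pos x Hx). apply filter_imp. intros t Ht.
    symmetry. now apply struveL_eq. }
  evar_last.
  - apply (is_derive_mult (fun x => Rpower (x / 2) (nu + 1))
      (fun x => struve_series (nu + 3 / 2) ((x / 2) ^ 2))); [| |intros; apply Rmult_comm].
    + apply (is_derive_comp (fun u => Rpower u (nu + 1)) (fun x => x / 2)).
      * apply is_derive_Rpower. lra.
      * apply (is_derive_ext (fun x => x * / 2)); [reflexivity|].
        auto_derive; [exact I|reflexivity].
    + apply (is_derive_comp (struve_series (nu + 3 / 2)) (fun x => (x / 2) ^ 2)).
      * apply is_derive_struve_series. lra.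
      * auto_derive; [exact I|reflexivity].
  - unfold plus, mult, scal; simpl. unfold mult; simpl. field. lra.
Qed.

(** The inhomogeneous term [t] by which the modified Struve functions fail to
    satisfy the recurrences of the modified Bessel functions. *)
Definition struve_defect (nu x : R) : R :=
  Rpower (x / 2) nu / (2 * Gamma (3 / 2) * Gamma (nu + 3 / 2)).

Lemma struve_defect_pos (nu x : R) : - (3 / 2) < nu -> 0 < struve_defect nu x.
Proof.
  intros Hnu. apply Rdiv_lt_0_compat; [apply exp_pos|].
  apply Rmult_lt_0_compat; [apply Rmult_lt_0_compat; [lra|]|]; apply Gamma_pos; lra.
Qed.

Lemma is_derive_struveL (nu x : R) : - (3 / 2) < nu -> 0 < x ->
  is_derive (struveL nu) x
    (struveL (nu + 1) x + nu / x * struveL nu x + struve_defect nu x).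
Proof.
  intros Hnu Hx. evar_last; [now apply is_derive_struveL_series|].
  rewrite !struveL_eq by exact Hx. unfold struve_defect.
  rewrite !(Rpower_succ (x / 2)) by lra.
  pose proof (struve_series_raise (nu + 3 / 2) ((x / 2) ^ 2) ltac:(lra)) as H.
  replace (nu + 1 + 3 / 2) with (nu + 3 / 2 + 1) by ring.
  set (y := (x / 2) ^ 2) in *.
  assert (E : x / 2 * struve_series' (nu + 3 / 2) y
    = 2 / x * (/ (2 * Gamma (3 / 2) * Gamma (nu + 3 / 2))
        + y * struve_series (nu + 3 / 2 + 1) y - 1 / 2 * struve_series (nu + 3 / 2) y)).
  { rewrite <- H. unfold y. field. lra. }
  rewrite E. set (s := struve_series (nu + 3 / 2) y). set (s' := struve_series _ y).
  unfold y.
  pose proof (Gamma_pos (3 / 2) ltac:(lra)). pose proof (Gamma_pos (nu + 3 / 2) ltac:(lra)).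
 field. repeat split; lra.
Qed.

Lemma is_derive_struveL_succ (nu x : R) : - (3 / 2) < nu -> 0 < x ->
  is_derive (struveL (nu + 1)) x
    (struveL nu x - (nu + 1) / x * struveL (nu + 1) x).
Proof.
  intros Hnu Hx. evar_last; [apply is_derive_struveL_series; lra|].
  rewrite !struveL_eq by exact Hx.
  rewrite !(Rpower_succ (x / 2)) by lra.
  pose proof (struve_series_lower (nu + 3 / 2) ((x / 2) ^ 2) ltac:(lra)) as H.
  replace (nu + 1 + 3 / 2) with (nu + 3 / 2 + 1) by ring.
  rewrite <- H. field. lra.
Qed.

(** Each coefficient of [L_(nu+1)] is [(x/2) / (k + nu + 3/2)] times the
    corresponding one of [L_nu]; in closed form, this is the nonnegativity of the
    derivative of the series of [L_(nu+1)]. *)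
Lemma struveL_ratio_le (nu x : R) : - (3 / 2) < nu -> 0 < x ->
  (2 * nu + 3) * struveL (nu + 1) x <= x * struveL nu x.
Proof.
  intros Hnu Hx. rewrite !struveL_eq by exact Hx.
  rewrite !(Rpower_succ (x / 2)) by lra.
  pose proof (struve_series_lower (nu + 3 / 2) ((x / 2) ^ 2) ltac:(lra)) as H.
  replace (nu + 1 + 3 / 2) with (nu + 3 / 2 + 1) by ring.
  pose proof (struve_series'_ge_0 (nu + 3 / 2 + 1) ((x / 2) ^ 2) ltac:(lra) (pow2_ge_0 _)) as H'.
  pose proof (Rmult_le_pos _ _ (pow2_ge_0 (x / 2)) H').
  set (s := struve_series (nu + 3 / 2) _) in *. set (s' := struve_series (nu + 3 / 2 + 1) _) in *.
  assert (HP : 0 <= x ^ 2 / 2 * Rpower (x / 2) nu).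
  { apply Rmult_le_pos; [nra|apply Rlt_le, exp_pos]. }
  assert (HH : 0 <= (x ^ 2 / 2 * Rpower (x / 2) nu) * (s - (nu + 3 / 2) * s')).
  { apply Rmult_le_pos; [exact HP|]. lra. }
  lra.
Qed.

(** This is [h < x / (x + m)] for [h = L_(nu+1) / L_nu] and [m = nu + 1/2].  For
    [D = x L_nu - (x + m) L_(nu+1)], the two differentiation formulas give
    [D' = - p D + positive] with [p = 1 + (nu+1)/x - (m+1)/(x+m)], so [D] times
    the integrating factor [e^x x^(nu+1) (x+m)^(-(m+1))] increases; [D] is positive
    on [(0, 1]] by [struveL_ratio_le]. *)
Lemma struveL_ratio_lt (nu x : R) : - (1 / 2) < nu -> 0 < x ->
  (x + (nu + 1 / 2)) * struveL (nu + 1) x < x * struveL nu x.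
Proof.
  intros Hnu Hx. set (m := nu + 1 / 2).
  set (D := fun x => x * struveL nu x - (x + m) * struveL (nu + 1) x).
  set (E := fun x => exp x * Rpower x (nu + 1) * Rpower (x + m) (- (m + 1))).
  assert (Hm : 0 < m) by (unfold m; lra).
  assert (HE : forall t, 0 < E t).
  { intros t. repeat apply Rmult_lt_0_compat; apply exp_pos. }
  assert (Hsmall : forall t, 0 < t <= 1 -> 0 < D t).
  { intros t Ht. unfold D.
    pose proof (struveL_ratio_le nu t ltac:(lra) ltac:(lra)) as H.
    pose proof (struveL_pos (nu + 1) t ltac:(lra) ltac:(lra)) as H1.
    assert ((t + m) * struveL (nu + 1) t < (2 * nu + 3) * struveL (nu + 1) t).
    { apply Rmult_lt_compat_r; [exact H1|]. unfold m. lra. }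
    lra. }
  assert (HD : forall t, 0 < t -> is_derive (fun t => E t * D t) t
     (E t * (m * (m + 1) / (t + m) * struveL nu t + t * struve_defect nu t))).
  { intros t Ht. evar_last.
    - apply (is_derive_mult E D); [| |intros; apply Rmult_comm].
      + apply (is_derive_mult (fun x => exp x * Rpower x (nu + 1))
          (fun x => Rpower (x + m) (- (m + 1)))); [| |intros; apply Rmult_comm].
        * apply (is_derive_mult exp (fun x => Rpower x (nu + 1)));
            [apply is_derive_exp|now apply is_derive_Rpower|intros; apply Rmult_comm].
        * apply (is_derive_comp (fun u => Rpower u (- (m + 1))) (fun x => x + m)).
          -- apply is_derive_Rpower. lra.
          -- auto_derive; [exact I|reflexivity].
      + apply (is_derive_minus (V := R_NormedModule) (fun x => x * struveL nu x)
                 (fun x => (x + m) * struveL (nu + 1) x)).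
        * apply (is_derive_mult (fun x => x) (struveL nu)); [| |intros; apply Rmult_comm].
          -- apply (is_derive_id (K := R_AbsRing)).
          -- apply is_derive_struveL; lra.
        * apply (is_derive_mult (fun x => x + m) (struveL (nu + 1)));
            [| |intros; apply Rmult_comm].
          -- auto_derive; [exact I|reflexivity].
          -- apply is_derive_struveL_succ; lra.
    - unfold E, D, minus, plus, opp, mult, scal, one; simpl. unfold mult; simpl.
      replace nu with (m - 1 / 2) by (unfold m; lra).
      field. lra. }
  destruct (Rle_lt_dec x 1) as [Hx1|Hx1].
  { specialize (Hsmall x (conj Hx Hx1)). unfold D in Hsmall. lra. }
  assert (Hinc : E 1 * D 1 <= E x * D x).
  { destruct (MVT_gen (fun t => E t * D t) 1 x
      (fun t => E t * (m * (m + 1) / (t + m) * struveL nu t + t * struve_defect nu t)))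
      as (c & Hc & Heq).
    - rewrite Rmin_left, Rmax_right by lra. intros t Ht. apply HD. lra.
    - rewrite Rmin_left, Rmax_right by lra. intros t Ht. apply continuity_pt_filterlim.
      apply (continuous_of_is_derive _ _ _ (HD t ltac:(lra))).
    - rewrite Rmin_left, Rmax_right in Hc by lra.
      pose proof (struveL_pos nu c ltac:(lra) ltac:(lra)) as H1.
      pose proof (struve_defect_pos nu c ltac:(lra)) as H2.
      assert (0 <= E c * (m * (m + 1) / (c + m) * struveL nu c + c * struve_defect nu c)).
      { apply Rmult_le_pos; [apply Rlt_le, HE|]. apply Rplus_le_le_0_compat.
        - apply Rmult_le_pos; [|lra]. apply Rlt_le, Rdiv_lt_0_compat; nra.
        - apply Rmult_le_pos; lra. }
      assert (0 <= E x * D x - E 1 * D 1); [|lra].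
      rewrite Heq. apply Rmult_le_pos; lra. }
  pose proof (Rmult_lt_0_compat _ _ (HE 1) (Hsmall 1 ltac:(lra))) as H1.
  assert (HDx : 0 < D x).
  { apply Rmult_lt_reg_l with (E x); [apply HE|]. lra. }
  unfold D in HDx. lra.
Qed.

(** * Comparison of increments and the upper bounds *)

(** All functions here live on the open half-line and tend to [0] at [0], whereas
    their formulas take junk values at [0] (as [Rpower 0 y = 1]).  Extending them
    by zero makes them continuous on the line, so that primitives based at [0] can
    be differentiated freely. *)
Definition ext0 (f : R -> R) (x : R) : R := if Rlt_dec 0 x then f x else 0.

Lemma ext0_pos (f : R -> R) (x : R) : 0 < x -> ext0 f x = f x.
Proof. intros Hx. unfold ext0. destruct (Rlt_dec 0 x); [reflexivity|lra]. Qed.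

Lemma ext0_0 (f : R -> R) : ext0 f 0 = 0.
Proof. unfold ext0. destruct (Rlt_dec 0 0); [lra|reflexivity]. Qed.

Lemma continuous_ext0 (f : R -> R) :
  (forall t, 0 < t -> continuous f t) ->
  filterlim f (at_right 0) (locally 0) ->
  forall t, continuous (ext0 f) t.
Proof.
  intros Hf H0 t. destruct (Rtotal_order t 0) as [Ht|[->|Ht]].
  - apply (continuous_ext_loc _ (fun _ => 0)); [|apply continuous_const].
    generalize (open_lt 0 t Ht). apply filter_imp. intros s Hs. unfold ext0.
    destruct (Rlt_dec 0 s); [lra|reflexivity].
  - intros P HP. rewrite ext0_0 in HP. specialize (H0 P HP).
    unfold filtermap, at_right, within in *. generalize H0. apply filter_imp.
    intros s Hs. unfold ext0. destruct (Rlt_dec 0 s) as [h|h]; [now apply Hs|].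
    now apply locally_singleton.
  - apply (continuous_ext_loc _ f); [|now apply Hf].
    generalize (locally_pos t Ht). apply filter_imp. intros s Hs.
    symmetry. now apply ext0_pos.
Qed.

Lemma is_derive_ext0 (f : R -> R) (x l : R) :
  0 < x -> is_derive f x l -> is_derive (ext0 f) x l.
Proof.
  intros Hx. apply is_derive_ext_loc. generalize (locally_pos x Hx).
  apply filter_imp. intros t Ht. symmetry. now apply ext0_pos.
Qed.

Lemma RInt_ext0 (f : R -> R) (a b : R) : 0 <= a -> 0 <= b ->
  RInt (ext0 f) a b = RInt f a b.
Proof.
  intros Ha Hb. apply RInt_ext. intros t [Ht _]. apply ext0_pos.
  apply Rle_lt_trans with (2 := Ht). now apply Rmin_glb.
Qed.

Lemma filterlim_Rpower_mul_0 (p : R) (g : R -> R) : 0 < p -> continuous g 0 ->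
  filterlim (fun x => Rpower x p * g x) (at_right 0) (locally 0).
Proof.
  intros Hp Hg.
  replace 0 with (0 * g 0) at 2 by ring.
  apply (filterlim_comp_2 (H := locally (g 0)) (G := locally 0)).
  - apply (filterlim_comp _ _ _ (fun x => p * ln x) exp _ (Rbar_locally m_infty)).
    + apply (filterlim_comp _ _ _ ln (fun y => p * y) _ (Rbar_locally m_infty)).
      * apply is_lim_ln_0.
      * replace m_infty with (Rbar_mult p m_infty) at 2.
        -- apply (filterlim_Rbar_mult_l p m_infty).
        -- apply is_Rbar_mult_unique, is_Rbar_mult_sym, is_Rbar_mult_m_infty_pos. exact Hp.
    + apply is_lim_exp_m.
  - apply (filterlim_filter_le_1 (F := locally 0) g); [apply filter_le_within|exact Hg].
  - apply (filterlim_mult (K := R_AbsRing) 0 (g 0)).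
Qed.

(** The mean value theorem for [g - f], in the form used to compare an integral
    with a closed expression without integrating the latter's derivative. *)
Lemma increment_lt (f g f' g' : R -> R) (a b : R) : a < b ->
  (forall x, a <= x <= b -> continuous f x /\ continuous g x) ->
  (forall x, a < x < b -> is_derive f x (f' x) /\ is_derive g x (g' x) /\ f' x < g' x) ->
  f b - f a < g b - g a.
Proof.
  intros Hab Hc Hd.
  assert (Hcont : forall x, a <= x <= b -> continuity_pt (fun x => g x - f x) x).
  { intros x Hx. apply continuity_pt_filterlim. destruct (Hc x Hx).
    now apply (continuous_minus g f). }
  assert (Hder : forall x, a < x < b -> is_derive (fun x => g x - f x) x (g' x - f' x)).
  { intros x Hx. destruct (Hd x Hx) as (H1 & H2 & _).
    now apply (is_derive_minus (V := R_NormedModule) g f). }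
  destruct (MVT (fun x => g x - f x) id a b
     (fun c Hx => exist _ (g' c - f' c) (proj1 (is_derive_Reals _ _ _) (Hder c Hx)))
     (fun c _ => derivable_pt_id c) Hab Hcont
     (fun c _ => derivable_continuous_pt _ _ (derivable_pt_id c))) as (c & Hx & Heq).
  rewrite derive_pt_id in Heq. simpl in Heq. unfold id in Heq.
  destruct (Hd c Hx) as (_ & _ & Hlt).
  assert (0 < (b - a) * (g' c - f' c)) by (apply Rmult_lt_0_compat; lra).
  unfold derive_pt in Heq; simpl in Heq. lra.
Qed.

Lemma is_derive_primitive (f : R -> R) (a x : R) :
  (forall t, continuous f t) -> is_derive (fun x => RInt f a x) x (f x).
Proof.
  intros Hf. apply (is_derive_RInt (V := R_NormedModule) f _ a x); [|apply Hf].
  apply filter_forall. intros y. apply (RInt_correct (V := R_CompleteNormedModule)).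
  apply (ex_RInt_continuous (V := R_CompleteNormedModule)). intros; apply Hf.
Qed.

(** For [p = mu = nu] this is the integrand, and for [p = nu], [mu = nu + 1] the
    function in the upper bounds. *)
Definition wstruve (beta p mu x : R) : R := exp (- beta * x) * Rpower x p * struveL mu x.

Lemma wstruve_pos (beta p mu x : R) : - (3 / 2) < mu -> 0 < x -> 0 < wstruve beta p mu x.
Proof.
  intros Hmu Hx. repeat apply Rmult_lt_0_compat; try apply exp_pos. now apply struveL_pos.
Qed.

Lemma is_derive_wstruve (beta p mu x l : R) : 0 < x -> is_derive (struveL mu) x l ->
  is_derive (wstruve beta p mu) x
    (exp (- beta * x) * Rpower x p * l + (p / x - beta) * wstruve beta p mu x).
Proof.
  intros Hx Hl. evar_last.
  - apply (is_derive_mult (fun x => exp (- beta * x) * Rpower x p) (struveL mu));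
      [|exact Hl|intros; apply Rmult_comm].
    apply (is_derive_mult (fun x => exp (- beta * x)) (fun x => Rpower x p));
      [|now apply is_derive_Rpower|intros; apply Rmult_comm].
    auto_derive; [exact I|reflexivity].
  - unfold wstruve, plus, mult; simpl. ring.
Qed.

Lemma continuous_ext0_wstruve (beta p mu : R) : - (3 / 2) < mu -> 0 < p + mu + 1 ->
  forall t, continuous (ext0 (wstruve beta p mu)) t.
Proof.
  intros Hmu Hp. apply continuous_ext0.
  - intros t Ht. eapply continuous_of_is_derive.
    apply is_derive_wstruve; [exact Ht|]. now apply is_derive_struveL.
  - apply (@filterlim_within_ext _ _ _ _ _ _ (fun x => Rpower x (p + mu + 1) *
      (exp (- beta * x) * Rpower (/ 2) (mu + 1) * struve_series (mu + 3 / 2) ((x / 2) ^ 2)))).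
    { intros x Hx. unfold wstruve. rewrite struveL_eq by exact Hx.
      replace (Rpower (x / 2) (mu + 1)) with (Rpower x (mu + 1) * Rpower (/ 2) (mu + 1))
        by (apply Rpower_mult_distr; lra).
      replace (Rpower x (p + mu + 1)) with (Rpower x p * Rpower x (mu + 1))
        by (rewrite <- Rpower_plus; f_equal; ring).
      ring. }
    apply filterlim_Rpower_mul_0; [exact Hp|].
    apply (continuous_mult (fun x => exp (- beta * x) * Rpower (/ 2) (mu + 1))
             (fun x => struve_series (mu + 3 / 2) ((x / 2) ^ 2))).
    + apply (ex_derive_continuous (fun x => exp (- beta * x) * Rpower (/ 2) (mu + 1))).
      auto_derive. exact I.
    + apply (continuous_comp (fun x => (x / 2) ^ 2) (struve_series (mu + 3 / 2))).
      * apply (ex_derive_continuous (fun x => (x / 2) ^ 2)). auto_derive. exact I.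
      * eapply continuous_of_is_derive. apply is_derive_struve_series. lra.
Qed.

Lemma is_derive_wstruve_succ (beta nu x : R) : - (3 / 2) < nu -> 0 < x ->
  is_derive (ext0 (wstruve beta nu (nu + 1))) x
    (wstruve beta nu nu x - (beta + 1 / x) * wstruve beta nu (nu + 1) x).
Proof.
  intros Hnu Hx. apply is_derive_ext0; [exact Hx|]. evar_last.
  - apply is_derive_wstruve; [exact Hx|]. now apply is_derive_struveL_succ.
  - unfold wstruve. field. lra.
Qed.

Lemma wstruve_succ_le (beta nu x : R) : - (3 / 2) < nu -> 0 < x ->
  (2 * nu + 3) * wstruve beta nu (nu + 1) x <= x * wstruve beta nu nu x.
Proof.
  intros Hnu Hx. pose proof (struveL_ratio_le nu x Hnu Hx) as H. unfold wstruve.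
  assert (HP : 0 <= exp (- beta * x) * Rpower x nu) by (apply Rmult_le_pos; apply Rlt_le, exp_pos).
  pose proof (Rmult_le_compat_l _ _ _ HP H). lra.
Qed.

Lemma wstruve_succ_lt (beta nu x : R) : - (1 / 2) < nu -> 0 < x ->
  (x + (nu + 1 / 2)) * wstruve beta nu (nu + 1) x < x * wstruve beta nu nu x.
Proof.
  intros Hnu Hx. pose proof (struveL_ratio_lt nu x Hnu Hx) as H. unfold wstruve.
  assert (HP : 0 < exp (- beta * x) * Rpower x nu) by (apply Rmult_lt_0_compat; apply exp_pos).
  pose proof (Rmult_lt_compat_l _ _ _ HP H). lra.
Qed.

Lemma struve_integral_eq (beta nu x : R) : 0 <= x ->
  struve_integral beta nu x = RInt (ext0 (wstruve beta nu nu)) 0 x.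
Proof.
  intros Hx. rewrite RInt_ext0 by lra. reflexivity.
Qed.

(** The pointwise hypothesis is [J < (Psi F)'], as
    [F' = J - (beta + 1/x) F]. *)
Lemma struve_integral_increment (beta nu a b : R) (Psi Psi' : R -> R) :
  - (1 / 2) < nu -> 0 <= a -> a < b ->
  (forall x, is_derive Psi x (Psi' x)) ->
  (forall x, a < x < b -> wstruve beta nu nu x
     < Psi' x * wstruve beta nu (nu + 1) x
       + Psi x * (wstruve beta nu nu x - (beta + 1 / x) * wstruve beta nu (nu + 1) x)) ->
  struve_integral beta nu b - struve_integral beta nu a
  < Psi b * ext0 (wstruve beta nu (nu + 1)) b - Psi a * ext0 (wstruve beta nu (nu + 1)) a.
Proof.
  intros Hnu Ha Hab HPsi H. rewrite !struve_integral_eq by lra.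
  pose proof (continuous_ext0_wstruve beta nu nu ltac:(lra) ltac:(lra)) as HcJ.
  pose proof (continuous_ext0_wstruve beta nu (nu + 1) ltac:(lra) ltac:(lra)) as HcF.
  apply (increment_lt (fun x => RInt (ext0 (wstruve beta nu nu)) 0 x)
           (fun x => Psi x * ext0 (wstruve beta nu (nu + 1)) x)
           (wstruve beta nu nu)
           (fun x => Psi' x * wstruve beta nu (nu + 1) x
       + Psi x * (wstruve beta nu nu x - (beta + 1 / x) * wstruve beta nu (nu + 1) x)) a b Hab).
  - intros x _. split.
    + eapply continuous_of_is_derive. now apply is_derive_primitive.
    + apply (continuous_mult Psi (ext0 (wstruve beta nu (nu + 1)))); [|apply HcF].
      apply (continuous_of_is_derive _ _ _ (HPsi x)).
  - intros x Hx. split; [|split; [|now apply H]].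
    + rewrite <- (ext0_pos (wstruve beta nu nu) x) by lra. now apply is_derive_primitive.
    + rewrite <- (ext0_pos (wstruve beta nu (nu + 1)) x) at 1 by lra.
      apply (is_derive_mult Psi (ext0 (wstruve beta nu (nu + 1))));
        [apply HPsi| |intros; apply Rmult_comm].
      apply is_derive_wstruve_succ; lra.
Qed.

Lemma struve_integral_0 (beta nu : R) : struve_integral beta nu 0 = 0.
Proof. apply (RInt_point (V := R_CompleteNormedModule)). Qed.

(** With [w = F / x], one has [F' = J - (beta x + 1) w], a convex combination of
    [J - w] and [J - (x + 1) w] with weights [1 - beta] and [beta].  The second is
    positive since [x + 1 <= x + m], and the first is at least
    [J (2 nu + 2) / (2 nu + 3)]. *)
Lemma struve_integral_lt_of_half_le (beta nu C x : R) :
  0 < beta -> beta < 1 -> 1 / 2 <= nu -> 0 < x ->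
  2 * nu + 3 <= C * ((2 * nu + 1) * (1 - beta)) ->
  struve_integral beta nu x < C * wstruve beta nu (nu + 1) x.
Proof.
  intros Hb0 Hb1 Hnu Hx HC.
  pose proof (struve_integral_increment beta nu 0 x (fun _ => C) (fun _ => 0)
    ltac:(lra) (Rle_refl 0) Hx (fun x => is_derive_const (V := R_NormedModule) C x)) as H.
  rewrite struve_integral_0, ext0_0, (ext0_pos _ x Hx) in H.
  enough (struve_integral beta nu x - 0 < C * wstruve beta nu (nu + 1) x - C * 0) by lra.
  apply H. clear H. intros t Ht.
  pose proof (wstruve_succ_le beta nu t ltac:(lra) ltac:(lra)) as H1.
  pose proof (wstruve_succ_lt beta nu t ltac:(lra) ltac:(lra)) as H2.
  pose proof (wstruve_pos beta nu nu t ltac:(lra) ltac:(lra)) as Hf.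
  pose proof (wstruve_pos beta nu (nu + 1) t ltac:(lra) ltac:(lra)) as Hg.
  set (f := wstruve beta nu nu t) in *. set (g := wstruve beta nu (nu + 1) t) in *.
  assert (Hg' : g = t * (g / t)) by (field; lra).
  assert (Hw : 0 < g / t) by (apply Rdiv_lt_0_compat; lra).
  set (w := g / t) in *.
  replace ((beta + 1 / t) * g) with ((beta * t + 1) * w) by (rewrite Hg'; field; lra).
  rewrite Hg' in H1, H2. clearbody w. clear Hg'.
  assert (H3 : (2 * nu + 3) * w <= f) by (apply Rmult_le_reg_l with t; lra).
  assert (H4 : (t + (nu + 1 / 2)) * w < f) by (apply Rmult_lt_reg_l with t; lra).
  assert (H5 : (t + 1) * w < f) by (apply Rle_lt_trans with (2 := H4); apply Rmult_le_compat_r; lra).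
  assert (H6 : (1 - beta) * (f - w) < f - (beta * t + 1) * w).
  { assert (0 < beta * (f - (t + 1) * w)) by (apply Rmult_lt_0_compat; lra). lra. }
  assert (HC0 : 0 < C).
  { apply Rmult_lt_reg_r with ((2 * nu + 1) * (1 - beta)); [apply Rmult_lt_0_compat|]; lra. }
  apply Rle_lt_trans with (C * ((1 - beta) * (f - w)));
    [|pose proof (Rmult_lt_compat_l _ _ _ HC0 H6); lra].
  apply Rmult_le_reg_l with (2 * nu + 1); [lra|].
  assert (0 < f - w).
  { assert (1 * w < (2 * nu + 3) * w) by (apply Rmult_lt_compat_r; lra). lra. }
  apply Rle_trans with ((2 * nu + 3) * (f - w)).
  - lra.
  - pose proof (Rmult_le_compat_r (f - w) _ _ ltac:(lra) HC). lra.
Qed.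

(** As [beta < 1], the inequality [J < ((2 + 2 x / m) F)'] reduces to
    [2 (m x + x^2 + m) F <= x (m + 2 x) J].  The bound [h < x / (x + m)] yields it
    for [x >= 2 - m], and [h <= x / (2 m + 2)] for [x <= 2 - m]. *)
Lemma struve_integral_lt_linear (beta nu x : R) :
  0 < beta -> beta < 1 -> - (1 / 2) < nu -> nu < 1 / 2 -> 0 < x ->
  struve_integral beta nu x < (2 + 4 / (2 * nu + 1) * x) * wstruve beta nu (nu + 1) x.
Proof.
  intros Hb0 Hb1 Hnu0 Hnu1 Hx.
  assert (Hder : forall x, is_derive (fun x => 2 + 4 / (2 * nu + 1) * x) x (4 / (2 * nu + 1))).
  { intros t. auto_derive; [exact I|]. ring. }
  pose proof (struve_integral_increment beta nu 0 x _ _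
    ltac:(lra) (Rle_refl 0) Hx Hder) as H.
  rewrite struve_integral_0, ext0_0, (ext0_pos _ x Hx) in H.
  enough (struve_integral beta nu x - 0 <
    (2 + 4 / (2 * nu + 1) * x) * wstruve beta nu (nu + 1) x
    - (2 + 4 / (2 * nu + 1) * 0) * 0) by lra.
  apply H. clear H. intros t Ht.
  pose proof (wstruve_succ_le beta nu t ltac:(lra) ltac:(lra)) as H1.
  pose proof (wstruve_succ_lt beta nu t ltac:(lra) ltac:(lra)) as H2.
  pose proof (wstruve_pos beta nu nu t ltac:(lra) ltac:(lra)) as Hf.
  pose proof (wstruve_pos beta nu (nu + 1) t ltac:(lra) ltac:(lra)) as Hg.
  set (f := wstruve beta nu nu t) in *. set (g := wstruve beta nu (nu + 1) t) in *.
  set (m := nu + 1 / 2) in *.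
  assert (Hm : 0 < m < 1) by (unfold m; lra).
  replace (2 * nu + 1) with (2 * m) by (unfold m; lra).
  replace (2 * nu + 3) with (2 * m + 2) in H1 by (unfold m; lra).
  clearbody m f g.
  (* The inequality to prove, multiplied by [m * t], in the limiting case [beta = 1] *)
  assert (Hkey : 2 * (m * t + t ^ 2 + m) * g <= t * (m + 2 * t) * f).
  { destruct (Rle_lt_dec t (2 - m)) as [Hs|Hs].
    - apply Rle_trans with ((m + 2 * t) * ((2 * m + 2) * g)).
      + assert (0 <= ((m + 2 * t) * (m + 1) - (m * t + t ^ 2 + m)) * g); [|lra].
        apply Rmult_le_pos; [|lra].
        assert (0 <= t * (2 - m - t)) by (apply Rmult_le_pos; lra).
        assert (0 < m * t) by (apply Rmult_lt_0_compat; lra). nra.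
      + pose proof (Rmult_le_compat_l (m + 2 * t) _ _ ltac:(lra) H1). lra.
    - apply Rle_trans with ((m + 2 * t) * ((t + m) * g)).
      + assert (0 <= ((m + 2 * t) * (t + m) - 2 * (m * t + t ^ 2 + m)) * g); [|lra].
        apply Rmult_le_pos; [|lra].
        assert (0 <= m * (t + m - 2)) by (apply Rmult_le_pos; lra). lra.
      + pose proof (Rmult_lt_compat_l (m + 2 * t) _ _ ltac:(lra) H2). lra. }
  apply Rmult_lt_reg_l with (m * t); [apply Rmult_lt_0_compat; lra|].
  replace (m * t * (4 / (2 * m) * g + (2 + 4 / (2 * m) * t) * (f - (beta + 1 / t) * g)))
    with (2 * t * (m + t) * f - (2 * beta * t * (m + t) + 2 * m) * g) by (field; lra).
  assert (beta * (t * (m + t) * g) < 1 * (t * (m + t) * g)).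
  { apply Rmult_lt_compat_r; [|exact Hb1]. repeat apply Rmult_lt_0_compat; lra. }
  lra.
Qed.

(** The point [xs] solves [x + m = C (x (1 - beta) + m - 1)]; beyond it the bound
    [h < x / (x + m)] implies [J < C F'].  With [r = sqrt (2 (2 nu + 3))], so that
    [r^2 = 4 m + 4], the remaining requirement [2 + 2 xs / m <= C] reads
    [2 r (1 - beta m) <= 2 m + 2 + r], which holds because
    [2 m + 2 = r^2 / 2 >= r]. *)
Lemma struve_integral_lt_of_lt_half (beta nu x : R) :
  0 < beta -> beta < 1 -> - (1 / 2) < nu -> nu < 1 / 2 -> 0 < x ->
  struve_integral beta nu x
  < (2 * nu + 3 + sqrt (2 * (2 * nu + 3))) / ((2 * nu + 1) * (1 - beta))
    * wstruve beta nu (nu + 1) x.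
Proof.
  intros Hb0 Hb1 Hnu0 Hnu1 Hx.
  set (r := sqrt (2 * (2 * nu + 3))). set (m := nu + 1 / 2).
  assert (Hm : 0 < m < 1) by (unfold m; lra).
  assert (Hr2 : r * r = 4 * m + 4) by (unfold r, m; rewrite sqrt_sqrt; lra).
  assert (Hr0 : 0 <= r) by apply sqrt_pos.
  assert (Hr : 2 < r) by nra.
  set (C := (2 * nu + 3 + r) / ((2 * nu + 1) * (1 - beta))).
  assert (HC : C * (2 * m * (1 - beta)) = 2 * m + 2 + r).
  { unfold C. replace (2 * nu + 3) with (2 * m + 2) by (unfold m; lra).
    replace (2 * nu + 1) with (2 * m) by (unfold m; lra). field. lra. }
  set (xs := r * (1 - beta * m) / (2 * (1 - beta)) - m).
  assert (Hxs : xs * (2 * (1 - beta)) = r * (1 - beta * m) - 2 * m * (1 - beta)).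
  { unfold xs. field. lra. }
  assert (Hbm : beta * m < beta * 1) by (apply Rmult_lt_compat_l; lra).
  assert (Hxs0 : 0 < xs).
  { apply Rmult_lt_reg_r with (2 * (1 - beta)); [lra|]. rewrite Hxs, Rmult_0_l.
    assert (0 < r * (beta - beta * m)) by (apply Rmult_lt_0_compat; lra).
    assert (0 < (r - 2 * m) * (1 - beta)) by (apply Rmult_lt_0_compat; lra). lra. }
  (* Up to [xs] the coefficient of the linear bound stays below [C] *)
  assert (Hlow : forall t, 0 < t <= xs -> struve_integral beta nu t < C * wstruve beta nu (nu + 1) t).
  { intros t Ht.
    apply Rlt_le_trans with (1 := struve_integral_lt_linear beta nu t Hb0 Hb1 Hnu0 Hnu1 ltac:(lra)).
    apply Rmult_le_compat_r; [apply Rlt_le, wstruve_pos; lra|].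
    replace (2 * nu + 1) with (2 * m) by (unfold m; lra).
    apply Rmult_le_reg_r with (2 * m * (1 - beta)); [apply Rmult_lt_0_compat; lra|].
    rewrite HC.
    replace ((2 + 4 / (2 * m) * t) * (2 * m * (1 - beta)))
      with (4 * m * (1 - beta) + 2 * (t * (2 * (1 - beta)))) by (field; lra).
    assert (t * (2 * (1 - beta)) <= xs * (2 * (1 - beta))) by (apply Rmult_le_compat_r; lra).
    assert (0 < r * (beta * m)) by (repeat apply Rmult_lt_0_compat; lra).
    nra. }
  destruct (Rle_lt_dec x xs) as [Hle|Hlt]; [apply Hlow; lra|].
  pose proof (Hlow xs ltac:(lra)) as Hstart.
  pose proof (struve_integral_increment beta nu xs x (fun _ => C) (fun _ => 0)
    Hnu0 ltac:(lra) Hlt (fun x => is_derive_const (V := R_NormedModule) C x)) as H.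
  rewrite !ext0_pos in H by lra.
  enough (struve_integral beta nu x - struve_integral beta nu xs
    < C * wstruve beta nu (nu + 1) x - C * wstruve beta nu (nu + 1) xs) by lra.
  apply H. clear H. intros t Ht.
  pose proof (wstruve_succ_lt beta nu t ltac:(lra) ltac:(lra)) as H2.
  pose proof (wstruve_pos beta nu nu t ltac:(lra) ltac:(lra)) as Hf.
  pose proof (wstruve_pos beta nu (nu + 1) t ltac:(lra) ltac:(lra)) as Hg.
  set (f := wstruve beta nu nu t) in *. set (g := wstruve beta nu (nu + 1) t) in *.
  fold m in H2.
  assert (HC0 : 0 < C).
  { apply Rmult_lt_reg_r with (2 * m * (1 - beta)); [repeat apply Rmult_lt_0_compat|]; lra. }
  clearbody f g.
  assert (Ht' : xs * (2 * (1 - beta)) < t * (2 * (1 - beta))) by (apply Rmult_lt_compat_r; lra).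
  (* [C * (1 - (beta + 1 / t) * t / (t + m)) >= 1] beyond [xs] *)
  assert (HCt : t + m <= C * (t * (1 - beta) + m - 1)).
  { apply Rmult_le_reg_r with (2 * m * (1 - beta)); [repeat apply Rmult_lt_0_compat; lra|].
    replace (C * (t * (1 - beta) + m - 1) * (2 * m * (1 - beta)))
      with ((C * (2 * m * (1 - beta))) * (t * (1 - beta) + m - 1)) by ring.
    rewrite HC.
    set (z := t * (2 * (1 - beta))) in *.
    replace (t * (1 - beta)) with (z / 2) by (unfold z; field).
    replace ((t + m) * (2 * m * (1 - beta))) with (m * z + 2 * m * m * (1 - beta))
      by (unfold z; ring).
    assert (0 <= (z - (r * (1 - beta * m) - 2 * m * (1 - beta))) * (2 + r)).
    { apply Rmult_le_pos; lra. }
    nra. }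
  rewrite Rmult_0_l, Rplus_0_l.
  apply Rmult_lt_reg_l with (t * (t + m)); [repeat apply Rmult_lt_0_compat; lra|].
  replace (t * (t + m) * (C * (f - (beta + 1 / t) * g)))
    with (C * ((t * (t + m)) * f - (beta * t + 1) * ((t + m) * g))) by (field; lra).
  apply Rle_lt_trans with (C * ((t * (t + m)) * f - (beta * t + 1) * (t * f))).
  - replace (C * (t * (t + m) * f - (beta * t + 1) * (t * f)))
      with ((t * f) * (C * (t * (1 - beta) + m - 1))) by ring.
    replace (t * (t + m) * f) with ((t * f) * (t + m)) by ring.
    apply Rmult_le_compat_l; [apply Rmult_le_pos; lra|exact HCt].
  - apply Rmult_lt_compat_l; [exact HC0|].
    assert (0 < beta * t) by (apply Rmult_lt_0_compat; lra).
    pose proof (Rmult_lt_compat_l (beta * t + 1) _ _ ltac:(lra) H2). lra.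
Qed.

(** * The incomplete gamma function and the lower bound *)

(** A primitive of the zero extension is continuous at [0], so it gives the value
    of the improper integral. *)
Lemma is_RInt_gen_at_right_0 (f : R -> R) (x : R) : 0 < x ->
  (forall t, continuous (ext0 f) t) ->
  is_RInt_gen f (at_right 0) (at_point x) (RInt (ext0 f) 0 x).
Proof.
  intros Hx Hc P HP.
  assert (Hex : forall a b, ex_RInt (ext0 f) a b).
  { intros a b. apply (ex_RInt_continuous (V := R_CompleteNormedModule)). intros; apply Hc. }
  assert (Hcont : continuous (fun a => RInt (ext0 f) a x) 0).
  { apply (continuous_ext (fun a => opp (RInt (ext0 f) x a))).
    - intros a. apply (opp_RInt_swap (V := R_CompleteNormedModule)). apply Hex.
    - apply (continuous_opp (fun a => RInt (ext0 f) x a)).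
      eapply continuous_of_is_derive. now apply is_derive_primitive. }
  specialize (Hcont P HP).
  apply (Filter_prod (at_right 0) (at_point x) _
           (fun a => 0 < a /\ P (RInt (ext0 f) a x)) (fun b => b = x)).
  - unfold filtermap, at_right, within in *. generalize Hcont. apply filter_imp.
    intros a Ha Ha0. now split.
  - reflexivity.
  - intros a b [Ha HPa] ->. simpl. exists (RInt (ext0 f) a x). split; [|exact HPa].
    apply (is_RInt_ext (ext0 f)).
    + intros t [Ht _]. apply ext0_pos. apply Rlt_trans with (2 := Ht). now apply Rmin_glb_lt.
    + apply (RInt_correct (V := R_CompleteNormedModule)). apply Hex.
Qed.

Lemma continuous_ext0_gamma_integrand (a : R) : 1 < a ->
  forall t, continuous (ext0 (gamma_integrand a)) t.
Proof.
  intros Ha. apply continuous_ext0; [apply continuous_gamma_integrand|].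
  apply (filterlim_ext (fun t => Rpower t (a - 1) * exp (- t))).
  { intros t. apply Rmult_comm. }
  apply filterlim_Rpower_mul_0; [lra|].
  apply (ex_derive_continuous (fun t => exp (- t))). auto_derive. exact I.
Qed.

Lemma lower_gamma_eq (a x : R) : 1 < a -> 0 < x ->
  lower_gamma a x = RInt (ext0 (gamma_integrand a)) 0 x.
Proof.
  intros Ha Hx. apply (is_RInt_gen_unique (gamma_integrand a)).
  apply is_RInt_gen_at_right_0; [exact Hx|]. now apply continuous_ext0_gamma_integrand.
Qed.

Lemma struve_defect_le (nu x : R) : - (3 / 2) < nu ->
  struve_defect nu x <= Rpower (x / 2) nu / (sqrt PI * Gamma (nu + 3 / 2)).
Proof.
  intros Hnu. pose proof Gamma_three_half_ge as H.
  pose proof (sqrt_lt_R0 _ PI_RGT_0). pose proof (Gamma_pos (nu + 3 / 2) ltac:(lra)) as HG.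
  apply Rmult_le_compat_l; [apply Rlt_le, exp_pos|].
  apply Rinv_le_contravar; [apply Rmult_lt_0_compat; lra|].
  apply Rmult_le_compat_r; lra.
Qed.

Lemma struveL_succ_lt (nu x : R) : - (1 / 2) < nu -> 0 < x ->
  struveL (nu + 1) x < struveL nu x.
Proof.
  intros Hnu Hx. pose proof (struveL_ratio_lt nu x Hnu Hx) as H.
  pose proof (struveL_pos (nu + 1) x ltac:(lra) Hx) as H1.
  apply Rmult_lt_reg_l with x; [exact Hx|].
  assert (0 < (nu + 1 / 2) * struveL (nu + 1) x) by (apply Rmult_lt_0_compat; lra). lra.
Qed.

(** Both sides vanish at [0], and the derivative of the left one,
    [- beta J + F + (2 nu / x) J + e^(-beta x) x^nu t], is smaller term by term:
    [F < J], [L_nu < L_(nu-1)] in the third summand, and [struve_defect_le] in the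
    last one, which becomes the rescaled integrand of the incomplete gamma
    function. *)
Lemma wstruve_lt_integrals (beta nu x : R) : 0 < beta -> 1 / 2 < nu -> 0 < x ->
  wstruve beta nu nu x
  < (1 - beta) * struve_integral beta nu x
    + 2 * nu * struve_integral beta (nu - 1) x
    + lower_gamma (2 * nu + 1) (beta * x)
      / (sqrt PI * Rpower 2 nu * Rpower beta (2 * nu + 1) * Gamma (nu + 3 / 2)).
Proof.
  intros Hb Hnu Hx.
  assert (Hbx : 0 < beta * x) by (apply Rmult_lt_0_compat; assumption).
  rewrite lower_gamma_eq, !struve_integral_eq by lra.
  set (c := sqrt PI * Rpower 2 nu * Rpower beta (2 * nu + 1) * Gamma (nu + 3 / 2)).
  pose proof (sqrt_lt_R0 _ PI_RGT_0) as Hpi.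
  pose proof (Gamma_pos (nu + 3 / 2) ltac:(lra)) as HG.
  assert (Hc : 0 < c) by (unfold c; repeat apply Rmult_lt_0_compat; try apply exp_pos; lra).
  pose proof (continuous_ext0_wstruve beta nu nu ltac:(lra) ltac:(lra)) as HcJ.
  pose proof (continuous_ext0_wstruve beta (nu - 1) (nu - 1) ltac:(lra) ltac:(lra)) as HcJ'.
  pose proof (continuous_ext0_gamma_integrand (2 * nu + 1) ltac:(lra)) as HcG.
  set (I1 := fun x => RInt (ext0 (wstruve beta nu nu)) 0 x).
  set (I2 := fun x => RInt (ext0 (wstruve beta (nu - 1) (nu - 1))) 0 x).
  set (I3 := fun x => RInt (ext0 (gamma_integrand (2 * nu + 1))) 0 x).
  set (g := fun x => (1 - beta) * I1 x + 2 * nu * I2 x + I3 (beta * x) / c).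
  set (g' := fun x => (1 - beta) * ext0 (wstruve beta nu nu) x
     + 2 * nu * ext0 (wstruve beta (nu - 1) (nu - 1)) x
     + beta * ext0 (gamma_integrand (2 * nu + 1)) (beta * x) / c).
  assert (Hg : forall t, is_derive g t (g' t)).
  { intros t. unfold g, g'.
    apply (is_derive_plus (V := R_NormedModule) (fun x => (1 - beta) * I1 x + 2 * nu * I2 x)).
    - apply (is_derive_plus (V := R_NormedModule) (fun x => (1 - beta) * I1 x)).
      + apply (is_derive_scal I1). now apply is_derive_primitive.
      + apply (is_derive_scal I2). now apply is_derive_primitive.
    - apply (is_derive_scal_l (V := R_NormedModule) (fun x => I3 (beta * x))).
      apply (is_derive_comp (V := R_NormedModule) I3 (fun x => beta * x)).
      + now apply is_derive_primitive.
      + auto_derive; [exact I|ring]. }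
  assert (H0 : g 0 = 0).
  { unfold g, I1, I2, I3. rewrite Rmult_0_r, !RInt_point. unfold zero; simpl.
    unfold Rdiv. ring. }
  rewrite <- (ext0_pos (wstruve beta nu nu) x Hx).
  change (ext0 (wstruve beta nu nu) x < g x).
  enough (ext0 (wstruve beta nu nu) x - ext0 (wstruve beta nu nu) 0 < g x - g 0)
    by (rewrite ext0_0, H0 in *; lra).
  apply (increment_lt _ _
    (fun x => exp (- beta * x) * Rpower x nu
       * (struveL (nu + 1) x + nu / x * struveL nu x + struve_defect nu x)
       + (nu / x - beta) * wstruve beta nu nu x) g' 0 x Hx).
  { intros t _. split; [apply HcJ|]. apply (continuous_of_is_derive _ _ _ (Hg t)). }
  intros t Ht. split; [|split; [apply Hg|]].
  { apply is_derive_ext0; [lra|]. apply is_derive_wstruve; [lra|]. apply is_derive_struveL; lra. }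
  assert (Hbt : 0 < beta * t) by (apply Rmult_lt_0_compat; lra).
  unfold g'. rewrite !ext0_pos by lra.
  pose proof (struveL_succ_lt nu t ltac:(lra) ltac:(lra)) as L1.
  pose proof (struveL_succ_lt (nu - 1) t ltac:(lra) ltac:(lra)) as L2.
  replace (nu - 1 + 1) with nu in L2 by ring.
  pose proof (struve_defect_le nu t ltac:(lra)) as L3.
  assert (E : beta * gamma_integrand (2 * nu + 1) (beta * t) / c
    = exp (- beta * t) * Rpower t nu
      * (Rpower (t / 2) nu / (sqrt PI * Gamma (nu + 3 / 2)))).
  { unfold gamma_integrand, c.
    replace (2 * nu + 1 - 1) with (nu + nu) by ring.
    replace (Rpower beta (2 * nu + 1)) with (beta * Rpower beta (nu + nu))
      by (rewrite <- Rpower_succ by exact Hb; f_equal; ring).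
    replace (Rpower (beta * t) (nu + nu)) with (Rpower beta (nu + nu) * Rpower t (nu + nu))
      by (apply Rpower_mult_distr; lra).
    replace (Rpower (t / 2) nu) with (Rpower t nu * / Rpower 2 nu).
    2:{
        replace t with (2 * (t / 2)) at 1 by field.
        rewrite <- (Rpower_mult_distr 2 (t / 2)) by lra.
        field. apply Rgt_not_eq, exp_pos. }
    rewrite Rpower_plus. replace (- (beta * t)) with (- beta * t) by ring.
    rewrite Rpower_plus.
    assert (Rpower beta nu <> 0) by apply Rgt_not_eq, exp_pos.
    assert (Rpower 2 nu <> 0) by apply Rgt_not_eq, exp_pos.
    field. repeat split; lra. }
  rewrite E. unfold wstruve.
  replace (Rpower t (nu - 1)) with (Rpower t nu / t).
  2:{ unfold Rminus. rewrite Rpower_plus, Rpower_Ropp, Rpower_1 by lra. reflexivity. }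
  set (p := Rpower (t / 2) nu / (sqrt PI * Gamma (nu + 3 / 2))) in *.
  assert (He : 0 < exp (- beta * t)) by apply exp_pos.
  assert (HR : 0 < Rpower t nu) by apply exp_pos.
  set (e := exp (- beta * t)) in *. set (q := Rpower t nu) in *.
  assert (Hq : 0 < e * q) by (apply Rmult_lt_0_compat; assumption).
  assert (Hn : 0 < nu / t) by (apply Rdiv_lt_0_compat; lra).
  pose proof (Rmult_lt_compat_l _ _ _ Hn L2) as L4.
  replace (2 * nu * (e * (q / t) * struveL (nu - 1) t))
    with (e * q * (2 * (nu / t * struveL (nu - 1) t))) by (field; lra).
  assert (L5 : struveL (nu + 1) t + 2 * (nu / t * struveL nu t) + struve_defect nu t
    < struveL nu t + 2 * (nu / t * struveL (nu - 1) t) + p) by lra.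
  pose proof (Rmult_lt_compat_l _ _ _ Hq L5). lra.
Qed.

Lemma sqrt_2_mul_le (nu : R) : - (1 / 2) < nu -> nu <= 1 / 2 ->
  sqrt (2 * (2 * nu + 3)) <= 2 * sqrt 2.
Proof.
  intros H0 H1. replace (2 * sqrt 2) with (sqrt (2 ^ 2 * 2)).
  - apply sqrt_le_1_alt. lra.
  - rewrite sqrt_mult_alt, sqrt_pow2 by lra. reflexivity.
Qed.

Lemma struve_integral_lt_sqrt (beta nu x : R) :
  0 < beta -> beta < 1 -> - (1 / 2) < nu -> 0 < x ->
  struve_integral beta nu x
  < (2 * nu + 3 + sqrt (2 * (2 * nu + 3))) / ((2 * nu + 1) * (1 - beta))
    * wstruve beta nu (nu + 1) x.
Proof.
  intros Hb0 Hb1 Hnu Hx. destruct (Rlt_le_dec nu (1 / 2)) as [H|H].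
  - now apply struve_integral_lt_of_lt_half.
  - apply struve_integral_lt_of_half_le; try assumption.
    pose proof (sqrt_pos (2 * (2 * nu + 3))).
    field_simplify; [lra|]. split; lra.
Qed.

Lemma struve_integral_lt_const (beta nu x : R) :
  0 < beta -> beta < 1 -> - (1 / 2) < nu -> 0 < x ->
  struve_integral beta nu x
  < (2 * nu + 3 + 2 * sqrt 2) / ((2 * nu + 1) * (1 - beta))
    * wstruve beta nu (nu + 1) x.
Proof.
  intros Hb0 Hb1 Hnu Hx. destruct (Rlt_le_dec nu (1 / 2)) as [H|H].
  - apply Rlt_le_trans with (1 := struve_integral_lt_of_lt_half beta nu x Hb0 Hb1 Hnu H Hx).
    apply Rmult_le_compat_r; [apply Rlt_le, wstruve_pos; lra|].
    apply Rmult_le_compat_r.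
    + apply Rlt_le, Rinv_0_lt_compat, Rmult_lt_0_compat; lra.
    + pose proof (sqrt_2_mul_le nu Hnu ltac:(lra)). lra.
  - apply struve_integral_lt_of_half_le; try assumption.
    pose proof (sqrt_pos 2). field_simplify; [lra|]. split; lra.
Qed.

Lemma struve_integral_gt (beta nu x : R) :
  0 < beta -> beta < 1 -> 1 / 2 < nu -> 0 < x ->
  1 / (1 - beta)
  * ((1 - 2 * nu * (2 * nu + 1 + 2 * sqrt 2) / ((2 * nu - 1) * (1 - beta)) * (1 / x))
     * wstruve beta nu nu x
     - lower_gamma (2 * nu + 1) (beta * x)
       / (sqrt PI * Rpower 2 nu * Rpower beta (2 * nu + 1) * Gamma (nu + 3 / 2)))
  < struve_integral beta nu x.
Proof.
  intros Hb0 Hb1 Hnu Hx.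
  pose proof (wstruve_lt_integrals beta nu x Hb0 Hnu Hx) as H1.
  pose proof (struve_integral_lt_const beta (nu - 1) x Hb0 Hb1 ltac:(lra) Hx) as H2.
  replace (nu - 1 + 1) with nu in H2 by ring.
  replace (2 * (nu - 1) + 3) with (2 * nu + 1) in H2 by ring.
  replace (2 * (nu - 1) + 1) with (2 * nu - 1) in H2 by ring.
  replace (wstruve beta (nu - 1) nu x) with (1 / x * wstruve beta nu nu x) in H2.
  2:{ unfold wstruve, Rminus. rewrite Rpower_plus, Rpower_Ropp, Rpower_1 by exact Hx.
      unfold Rdiv. ring. }
  pose proof (Rmult_lt_compat_l (2 * nu) _ _ ltac:(lra) H2) as H3.
  set (T := lower_gamma _ _ / _) in *.
  unfold Rdiv at 1. rewrite Rmult_1_l, Rmult_comm.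
  apply Rlt_div_l; [lra|]. unfold Rdiv in *. lra.
Qed.

Theorem corollary2p6 (beta nu : R) (hbeta0 : 0 < beta) (hbeta1 : beta < 1) :
  (- (1 / 2) < nu ->
     forall x : R, 0 < x ->
       struve_integral beta nu x
       < (2 * nu + 3 + sqrt (2 * (2 * nu + 3))) / ((2 * nu + 1) * (1 - beta))
         * (exp (- beta * x) * Rpower x nu * struveL (nu + 1) x))
  /\
  (- (1 / 2) < nu ->
     forall x : R, 0 < x ->
       struve_integral beta nu x
       < (2 * nu + 3 + 2 * sqrt 2) / ((2 * nu + 1) * (1 - beta))
         * (exp (- beta * x) * Rpower x nu * struveL (nu + 1) x))
  /\
  (1 / 2 < nu ->
     forall x : R, 0 < x ->
       struve_integral beta nu x
       > 1 / (1 - beta)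
         * ((1 - 2 * nu * (2 * nu + 1 + 2 * sqrt 2)
                 / ((2 * nu - 1) * (1 - beta)) * (1 / x))
            * (exp (- beta * x) * Rpower x nu * struveL nu x)
            - lower_gamma (2 * nu + 1) (beta * x)
              / (sqrt PI * Rpower 2 nu * Rpower beta (2 * nu + 1)
                 * Gamma (nu + 3 / 2)))).
Proof.
  split; [|split]; intros Hnu x Hx.
  - now apply struve_integral_lt_sqrt.
  - now apply struve_integral_lt_const.
  - now apply struve_integral_gt.
Qed.
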